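(* Define, for $n\ge 0$, $$\gamma'_n = \frac{t^n (q;q)_{2n} (t^2, sz, sz^{-1};q)_\infty}{(t^2;q)_{2n} (t,tq,tz,tz^{-1};q)_\infty} \sum_{j=0}^{2n} \frac{(t;q)_j (t;q)_{2n-j}}{(q;q)_j (q;q)_{2n-j}}z^{j-n}$$ and $$\delta'_n = \frac{t^n (1-s q^{2n}) (q;q)_{2n} (s^2;q)_\infty}{(1-s) (s^2;q)_{2n} (s,sq;q)_\infty} \sum_{j=0}^{2n} \frac{(s;q)_j (s;q)_{2n-j}}{(q;q)_j (q;q)_{2n-j}}z^{j-n}.$$ Then $(\gamma'_n,\delta'_n)$ is a conjugate WP-Bailey pair relative to $(s,t,q)$, i.e. for every $n\ge0$, $$\gamma'_n=\sum_{l\ge n}\frac{(st^{-1};q)_{l-n}(s;q)_{l+n}}{(q;q)_{l-n}(tq;q)_{l+n}}\,\delta'_l.$$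
   Context: Here $q,s,t,z$ are complex numbers with $|q|<1$, $|t|<1$, $|s|<1$, $z\ne0$, $t\neq 0$, generic so that all denominators are nonzero and all series converge. The $q$-Pochhammer symbols are $(a;q)_\infty=\prod_{k\ge0}(1-aq^k)$, $(a;q)_n=(a;q)_\infty/(aq^n;q)_\infty$, and $(a_1,\dots,a_M;q)_n=(a_1;q)_n\cdots(a_M;q)_n$ (also for $n=\infty$). *)

(* Defs.v *)
From HB Require Import structures.
From mathcomp Require Import all_boot all_order all_algebra.
From mathcomp Require Import all_classical all_reals all_analysis.

Set Implicit Arguments.
Unset Strict Implicit.
Unset Printing Implicit Defensive.

Import Order.TTheory GRing.Theory Num.Theory.
Import numFieldNormedType.Exports.

Local Open Scope classical_set_scope.
Local Open Scope ring_scope.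

(* Everything is stated over a numFieldType with the topology of its norm; it is
   used with the complex numbers R[i], R : realType. *)
Section QSeries.
Variable C : numFieldType.
Implicit Types a q s t z : C.

(* (a; q)_oo, meaningful for `|q| < 1. *)
Definition qpoch_inf a q : C :=
  limn (fun N => \prod_(0 <= k < N) (1 - a * q ^+ k)).

(* (a; q)_n as a quotient of infinite products.  It agrees with the finite
   product of the 1 - a q^k, k < n, only when the denominator is nonzero
   (division by 0 being 0 here). *)
Definition qpoch a q (n : nat) : C := qpoch_inf a q / qpoch_inf (a * q ^+ n) q.

(* (a_1, ..., a_M; q)_oo *)
Definition qpochs_inf (A : seq C) q : C := \prod_(a <- A) qpoch_inf a q.

Definition gamma' q s t z (n : nat) : C :=
  (t ^+ n * qpoch q q (2 * n) * qpochs_inf [:: t ^+ 2; s * z; s * z^-1] q)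
  / (qpoch (t ^+ 2) q (2 * n) * qpochs_inf [:: t; t * q; t * z; t * z^-1] q)
  * \sum_(0 <= j < (2 * n).+1)
      (qpoch t q j * qpoch t q (2 * n - j))
      / (qpoch q q j * qpoch q q (2 * n - j)) * z ^ (j%:Z - n%:Z).

Definition delta' q s t z (n : nat) : C :=
  (t ^+ n * (1 - s * q ^+ (2 * n)) * qpoch q q (2 * n) * qpoch_inf (s ^+ 2) q)
  / ((1 - s) * qpoch (s ^+ 2) q (2 * n) * qpochs_inf [:: s; s * q] q)
  * \sum_(0 <= j < (2 * n).+1)
      (qpoch s q j * qpoch s q (2 * n - j))
      / (qpoch q q j * qpoch q q (2 * n - j)) * z ^ (j%:Z - n%:Z).

(* Partial sums, over n <= l < N, of the series defining a conjugate WP-Bailey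
   pair relative to (s, t, q). *)
Definition WP_partial_sum s t q (delta : nat -> C) (n N : nat) : C :=
  \sum_(n <= l < N)
    (qpoch (s * t^-1) q (l - n) * qpoch s q (l + n))
    / (qpoch q q (l - n) * qpoch (t * q) q (l + n)) * delta l.

Definition WP_series_cvg s t q (delta : nat -> C) : Prop :=
  forall n : nat, cvgn (WP_partial_sum s t q delta n).

Definition conjugate_WP_Bailey_pair s t q (gamma delta : nat -> C) : Prop :=
  forall n : nat, WP_partial_sum s t q delta n N @[N --> \oo] --> gamma n.

End QSeries.

(* Main.v *)
Require Import Defs.
From HB Require Import structures.
From mathcomp Require Import all_boot all_order all_algebra.
From mathcomp Require Import complex.
From mathcomp Require Import all_classical all_reals all_analysis.
From mathcomp Require Import ring zify.

(* Write c_l(b) = z^-l C_{2l}(z; b) for the symmetrised even Rogers polynomials,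
   F_n(s, t) for the series with the prefactor t^n (s^2)_oo / (s, sq)_oo removed,
   and G_n(s, t) for the claimed closed form of F_n.

   n = 0.  The three-term recurrence of c_l(sq), together with the lowering
   relation (1 - s q^{2l}) c_l(s) = (1 - s) (c_l(sq) - s c_{l-1}(sq)), gives a
   telescoping identity that relates the partial sums of F_0(s, t) and
   F_0(sq, tq); the remainder tends to 0.  Iterating, F_0(s q^k, t q^k) tends to
   1 and the accumulated factors tend to the infinite products of G_0.

   n -> n + 1.  Termwise,
     F_n(s, t) - t F_{n+1}(s, t) = (1 - t q^{2n+1}) / (1 - tq) F_n(s, tq),
   and G_n satisfies the same relation because (1 - tz)(1 - t/z) C_{2n}(z; tq) is
   a combination of C_{2n}(z; t) and C_{2n+2}(z; t).  When q = 0 the shifted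
   parameter tq vanishes and F_n(s, 0) has only two nonzero terms.

   Both steps need |tz| < 1 and |t/z| < 1.  These follow from the convergence of
   the series: for |z| > 1 its terms are (tz)^l C_{2l}(1/z; s) up to a factor
   with a nonzero limit, and if C_{2l}(w; s) tended to 0 for some |w| < 1 then so
   would C_{2l}(q^k w; s) for every k, contradicting
   C_{2l}(w; s) = (s)_{2l} / (q)_{2l} + O(w). *)

Set Implicit Arguments.
Unset Strict Implicit.
Unset Printing Implicit Defensive.

Import Order.TTheory GRing.Theory Num.Theory.
Import numFieldNormedType.Exports.

Local Open Scope classical_set_scope.
Local Open Scope ring_scope.
Local Open Scope complex_scope.

(** Derives an identity from known ones: a combination of known equations is supplied as x = y, and
    [ring] or [field] checks that it accounts for u - v. *)
Lemma eq_of_subr (K : zmodType) (x y u v : K) : x = y -> u - v = x - y -> u = v.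
Proof. by move=> -> /eqP; rewrite subrr subr_eq0 => /eqP. Qed.

(** * Cauchy products of coefficient sequences *)

Section Convolution.
Variable K : comNzRingType.
Implicit Types a b : nat -> K.

Definition conv a b m := \sum_(j < m.+1) a j * b (m - j)%N.
(** Multiplication of the generating function by its variable u. *)
Definition shift a (j : nat) := if j is i.+1 then a i else 0.

Lemma conv_shiftl a b : conv (shift a) b =1 shift (conv a b).
Proof.
case=> [|m]; rewrite /conv; first by rewrite big_ord1 mul0r.
rewrite big_ord_recl mul0r add0r.
by apply: eq_bigr => j _; rewrite /= /bump /= add1n subSS.
Qed.

Lemma conv_shiftr a b : conv a (shift b) =1 shift (conv a b).
Proof.
case=> [|m]; rewrite /conv; first by rewrite big_ord1 mulr0.
rewrite big_ord_recr /= subnn mulr0 addr0.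
by apply: eq_bigr => j _ /=; rewrite subSn // -ltnS.
Qed.

(** Coefficients of (1 - x u) A(u) (1 - y u) B(u), with the two linear factors expanded. *)
Lemma conv_linear_factors a b (x y : K) m :
  conv (fun j => a j - x * shift a j) (fun j => b j - y * shift b j) m
  = conv a b m - (x + y) * shift (conv a b) m
    + x * y * shift (shift (conv a b)) m.
Proof.
have <- : conv (shift a) (shift b) m = shift (shift (conv a b)) m.
  by rewrite conv_shiftl; case: m => //= m; rewrite conv_shiftr.
rewrite mulrDl -{1}conv_shiftl -conv_shiftr /conv opprD !addrA !mulr_sumr.
rewrite -!sumrN -!big_split /=.
by apply: eq_bigr => j _; ring.
Qed.

End Convolution.

(** * Rogers polynomials: recurrence, q-shift and change of parameter *)

Section Rogers.
Variables (K : fieldType) (q : K).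
Implicit Types (a b s t x z : K).
Hypothesis q1 : forall n, 1 - q ^+ n.+1 != 0.

Definition qfac a n := \prod_(i < n) (1 - a * q ^+ i).

Lemma qfac0 a : qfac a 0 = 1.
Proof. by rewrite /qfac big_ord0. Qed.

Lemma qfacS a n : qfac a n.+1 = qfac a n * (1 - a * q ^+ n).
Proof. by rewrite /qfac big_ord_recr. Qed.

Lemma qfac_recl a n : qfac a n.+1 = (1 - a) * qfac (a * q) n.
Proof.
rewrite /qfac big_ord_recl expr0 mulr1; congr (_ * _).
by apply: eq_bigr => i _; rewrite /= /bump /= add1n exprS mulrA.
Qed.

Lemma qfac_neq0 n : qfac q n != 0.
Proof.
by rewrite /qfac prodf_seq_neq0; apply/allP => i _ /=; rewrite -exprS.
Qed.

(** Coefficients of A(u) = (b u; q)_oo / (u; q)_oo, by the q-binomial theorem. *)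
Definition qratio b n := qfac b n / qfac q n.
(** The continuous q-ultraspherical polynomial C_m(cos theta; b | q) times e^(i m theta), at z =
    e^(2 i theta). Its generating function is A(u) A(z u). *)
Definition rogers b z m := \sum_(j < m.+1) qratio b j * qratio b (m - j) * z ^+ j.

Lemma rogersE b z m :
  rogers b z m = conv (fun j => qratio b j * z ^+ j) (qratio b) m.
Proof. by apply: eq_bigr => j _; rewrite mulrAC. Qed.

Lemma qratioS b n :
  (1 - q ^+ n.+1) * qratio b n.+1 = (1 - b * q ^+ n) * qratio b n.
Proof.
rewrite /qratio !qfacS -exprS; have := q1 n; have := qfac_neq0 n.
by move: (qfac q n) (q ^+ n.+1) => u v u0 v0; field; rewrite u0.
Qed.

Lemma conv_qexp (u v : nat -> K) m :
  conv (fun j => q ^+ j * u j) (fun j => q ^+ j * v j) m = q ^+ m * conv u v m.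
Proof.
rewrite /conv mulr_sumr; apply: eq_bigr => j _.
have -> : q ^+ m = q ^+ j * q ^+ (m - j) by rewrite -exprD subnKC // -ltnS.
by ring.
Qed.

(* For the generating function A(u) of qratio b, this reads
   (1 - y u) A(y u) = (1 - b y u) A(q y u). *)
Lemma qratio_qdiff b y j (a := fun i => qratio b i * y ^+ i) :
  a j - y * shift a j = q ^+ j * a j - b * y * shift (fun i => q ^+ i * a i) j.
Proof.
case: j => [|j] /=; first by rewrite /a !expr0; ring.
have := qratioS b j; rewrite /a !exprS => E.
apply: (eq_of_subr (congr1 ( *%R (y * y ^+ j)) E)); ring.
Qed.

(** The q-difference equations of A(z u) and A(u) multiply to (1 - z u)(1 - u) A(z u) A(u) = (1 - b
    z u)(1 - b u) A(q z u) A(q u); the recurrence is the coefficient of u^(m+2). *)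
Lemma rogers_rec b z m :
  (1 - q ^+ m.+2) * rogers b z m.+2
  = (1 + z) * (1 - b * q ^+ m.+1) * rogers b z m.+1
    - z * (1 - b ^+ 2 * q ^+ m) * rogers b z m.
Proof.
pose a y j := qratio b j * y ^+ j; have aE := qratio_qdiff b.
have := conv_linear_factors (a z) (a 1) z 1 m.+2.
have := conv_linear_factors (fun i => q ^+ i * a z i) (fun i => q ^+ i * a 1 i)
          (b * z) (b * 1) m.+2.
rewrite [in X in X -> _](_ : conv _ _ m.+2
  = conv (fun j => a z j - z * shift (a z) j) (fun j => a 1 j - 1 * shift (a 1) j) m.+2);
  last by apply: eq_bigr => j _; rewrite !aE.
move=> -> /=; rewrite !conv_qexp //.
have rE n : conv (a z) (a 1) n = rogers b z n.
  by rewrite rogersE; apply: eq_bigr => j _; rewrite /a expr1n mulr1.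
rewrite !rE !exprS => E.
apply: (eq_of_subr (esym E)); ring.
Qed.

(* Coefficients of (1 - z u) A(u) A(z u) = (1 - b z u) A(u) A(q z u) and of
   (1 - u) A(u) A(q z u) = (1 - b u) A(q u) A(q z u). *)
Lemma rogers_qshift b z m :
  (1 - q ^+ m.+1) * rogers b z m.+1
  = (z - b * q ^+ m) * rogers b z m + (1 - b * z) * rogers b (q * z) m.
Proof.
pose a y j := qratio b j * y ^+ j.
have rE y n : conv (a y) (a 1) n = rogers b y n.
  by rewrite rogersE; apply: eq_bigr => j _; rewrite /a expr1n mulr1.
have aq y j : q ^+ j * a y j = a (q * y) j by rewrite /a exprMn mulrCA.
have sE y j : shift (fun i => q ^+ i * a y i) j = shift (a (q * y)) j.
  by case: j => //= j; exact: aq.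
have E1 : rogers b z m.+1 - z * rogers b z m
          = rogers b (q * z) m.+1 - b * z * rogers b (q * z) m.
  have := conv_linear_factors (a z) (a 1) z 0 m.+1.
  have := conv_linear_factors (a (q * z)) (a 1) (b * z) 0 m.+1.
  rewrite /= !rE !(mulr0, mul0r, addr0) => <- <-; apply: eq_bigr => j _.
  by congr (_ * _); rewrite -sE -aq; exact: qratio_qdiff.
have E2 : rogers b (q * z) m.+1 - rogers b (q * z) m
          = q ^+ m.+1 * rogers b z m.+1 - b * (q ^+ m * rogers b z m).
  have := conv_linear_factors (a (q * z)) (a 1) 0 1 m.+1.
  have := conv_linear_factors (a (q * z)) (fun i => q ^+ i * a 1 i) 0 b m.+1.
  have qE i : conv (a (q * z)) (fun i => q ^+ i * a 1 i) i = q ^+ i * rogers b z i.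
    rewrite -rE -conv_qexp; apply: eq_bigr => j _; by rewrite -(aq z).
  rewrite /= !rE !qE !(mulr0, mul0r, addr0, add0r, mul1r) => <- <-; apply: eq_bigr => j _.
  by congr (_ * _); have := qratio_qdiff b 1 (m.+1 - j); rewrite mulr1.
apply: (eq_of_subr (congr2 +%R E1 E2)); ring.
Qed.

Lemma rogers0 b z : rogers b z 0 = 1.
Proof. by rewrite /rogers big_ord1 /qratio !qfac0 expr0 divr1 !mulr1. Qed.

Lemma rogers1 b z : (1 - q) * rogers b z 1 = (1 + z) * (1 - b).
Proof.
rewrite /rogers big_ord_recl big_ord1 /= /qratio !qfacS !qfac0 !expr0 expr1.
by rewrite !(mulr1, mul1r, divr1); have := q1 0; rewrite expr1 => h; field; rewrite h oner_neq0.
Qed.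

(** (b u; q)_oo = (1 - b u) (b q u; q)_oo, read off on coefficients. *)
Lemma qratio_contiguous b n :
  qratio b n = qratio (b * q) n - b * shift (qratio (b * q)) n.
Proof.
case: n => [|n]; first by rewrite /= /qratio !qfac0; ring.
have h := q1 n; apply: (mulfI h); rewrite /= mulrBr !qratioS.
have -> : (1 - b * q ^+ n) * qratio b n = (1 - b) * qratio (b * q) n.
  by rewrite /qratio mulrA [_ * qfac b n]mulrC -qfacS qfac_recl mulrA.
by rewrite exprS; ring.
Qed.


(** Two copies of [qratio_contiguous]: passing from bq to b multiplies the generating function by (1
    - b u)(1 - b z u). *)
Lemma rogers_contiguous b z m (C := rogers (b * q) z) :
  rogers b z m = C m - b * (1 + z) * shift C m + b ^+ 2 * z * shift (shift C) m.
Proof.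
have := conv_linear_factors (fun j => qratio (b * q) j * z ^+ j) (qratio (b * q))
          (b * z) b m.
have cE i : conv (fun j => qratio (b * q) j * z ^+ j) (qratio (b * q)) i = C i.
  by rewrite -rogersE.
have -> : shift (shift (conv (fun j => qratio (b * q) j * z ^+ j)
    (qratio (b * q)))) m = shift (shift C) m by case: m => [|[|m]] //=.
have -> : shift (conv (fun j => qratio (b * q) j * z ^+ j)
    (qratio (b * q))) m = shift C m by case: m.
rewrite cE (_ : conv _ _ m = rogers b z m); last first.
  rewrite rogersE; apply: eq_bigr => j _; rewrite -qratio_contiguous.
  rewrite [in RHS]qratio_contiguous; congr (_ * _).
  by case: (nat_of_ord j) => [|i] /=; rewrite ?exprS; ring.
by move=> ->; ring.
Qed.

(** [shift] supplies 0 at negative indices, so the recurrence at parameter bq holds from m = 0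
    on. *)
Lemma rogers_rec_shift b z m (C := rogers (b * q) z) :
  (1 - q ^+ m) * C m = (1 + z) * (1 - b * q ^+ m) * shift C m
    - z * (1 - b ^+ 2 * q ^+ m) * shift (shift C) m.
Proof.
case: m => [|[|m]] /=; first by rewrite expr0; ring.
  by rewrite /C expr1 rogers1 rogers0; ring.
by rewrite /C rogers_rec !exprS; ring.
Qed.

(** The recurrence eliminates the middle term [shift C m] of [rogers_contiguous]. *)
Lemma rogers_lower b z m (C := rogers (b * q) z) :
  (1 - b * q ^+ m) * rogers b z m = (1 - b) * (C m - b * z * shift (shift C) m).
Proof.
rewrite rogers_contiguous -/C.
have E := rogers_rec_shift b z m; rewrite -/C in E.
apply: (eq_of_subr (congr1 (fun x => b * x) E)); ring.
Qed.

(** Counterpart of [rogers_lower] in the other direction; it drives the step from n to n + 1. All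
    polynomials are expanded at parameter bq, where three instances of the recurrence settle the
    identity. *)
Lemma rogers_raise b z m : z != 0 ->
  (1 - b ^+ 2 * q ^+ m) * (1 - b ^+ 2 * q ^+ m.+1) * rogers b z m
  - b * (1 - q ^+ m.+1) * (1 - q ^+ m.+2) * (z^-1 * rogers b z m.+2)
  = (1 - b * q ^+ m.+1) * (1 - b) * ((1 - b * z) * (1 - b * z^-1))
    * rogers (b * q) z m.
Proof.
move=> z0; rewrite !(rogers_contiguous b) /=.
have E0 := rogers_rec_shift b z m.
have E1 := rogers_rec_shift b z m.+1.
have E2 := rogers_rec_shift b z m.+2.
move: E0 E1 E2 => /=.
set X := rogers _ _ m; set P := shift _ m; set U := shift (shift _) m.
move: (rogers _ _ _) (rogers _ _ _) X P U => x2 x1 X P U E0 E1 E2.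
(* Multiples of the recurrences at m, m + 1 and m + 2 that account for the difference of the two
   sides. *)
apply: (eq_of_subr (_ : b ^+ 2 * (1 - b ^+ 2 * q ^+ m.+1) * ((1 - q ^+ m) * X)
  - b * (1 - b) * (1 + z) / z * ((1 - q ^+ m.+1) * x1)
  - b * (1 - q ^+ m.+1) / z * ((1 - q ^+ m.+2) * x2) = _)).
  by rewrite E0 E1 E2; reflexivity.
by rewrite !exprS; field.
Qed.

(** A recurrence among indices of one parity, needed because the series involves only even
    indices. *)
Lemma rogers_two_step b z m (C := rogers (b * q) z) (u := q ^+ m) :
  (1 - b * u) * ((1 - q * u) * (1 - q ^+ 2 * u)) * C m.+2
  = (1 - b * q ^+ 2 * u) * ((1 + z) ^+ 2 * (1 - b * u) * (1 - b * q * u) * C m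
      - z * (1 - b ^+ 2 * q * u) *
        ((1 - u) * C m + z * (1 - b ^+ 2 * u) * shift (shift C) m))
    - z * (1 - b * u) * (1 - q * u) * (1 - b ^+ 2 * q ^+ 2 * u) * C m.
Proof.
have E0 := rogers_rec_shift b z m.
have E1 := rogers_rec_shift b z m.+1.
have E2 := rogers_rec_shift b z m.+2.
move: E0 E1 E2 => /=; rewrite -/C !exprS -/u => E0 E1 E2.
(* The ratio of [c1] to [c2] cancels [C m.+1]; that of [c0] to [c1] cancels [shift C m]. *)
pose c0 := z * (1 - b * q ^+ 2 * u) * (1 - b ^+ 2 * q * u).
pose c1 := (1 + z) * (1 - b * u) * (1 - b * q ^+ 2 * u).
pose c2 := (1 - b * u) * (1 - q * u).
apply: (eq_of_subr (congr2 +%R (congr2 +%R (congr1 ( *%R c0) E0)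
  (congr1 ( *%R c1) E1)) (congr1 ( *%R c2) E2))).
by rewrite /c0 /c1 /c2; ring.
Qed.

(* t^n (s/t; q)_n, in a form that makes sense at t = 0. *)
Definition fallprod s t n := \prod_(i < n) (t - s * q ^+ i).

Lemma fallprod0 s t : fallprod s t 0 = 1.
Proof. by rewrite /fallprod big_ord0. Qed.

Lemma fallprodS s t n : fallprod s t n.+1 = fallprod s t n * (t - s * q ^+ n).
Proof. by rewrite /fallprod big_ord_recr. Qed.

Lemma fallprodM s t x n : fallprod (s * x) (t * x) n = x ^+ n * fallprod s t n.
Proof.
elim: n => [|n IH]; first by rewrite !fallprod0 expr0 mulr1.
by rewrite !fallprodS IH exprS; ring.
Qed.

Lemma fallprod_qfac s t n : t != 0 -> fallprod s t n = t ^+ n * qfac (s * t^-1) n.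
Proof.
move=> t0; elim: n => [|n IH]; first by rewrite fallprod0 qfac0 expr0 mulr1.
by rewrite fallprodS qfacS IH exprS; field.
Qed.

(** * Terms of the series *)

Definition even_rogers b z l := z^-1 ^+ l * rogers b z (2 * l).

(* The l-th term of the series for gamma'_n divided by t^n (s^2; q)_oo / (s, sq; q)_oo. *)
Definition wp_term z n s t l :=
  qfac s (l + n) * fallprod s t (l - n) / (qfac q (l - n) * qfac (t * q) (l + n))
  * ((1 - s * q ^+ (2 * l)) / (1 - s) * (qfac q (2 * l) / qfac (s ^+ 2) (2 * l)))
  * even_rogers s z l.

(** What is left of the term at n = 0 once the lowering relation has removed (1 - s q^(2l)) / (1 -
    s) and the polynomials are split off. *)
Definition wp_weight s t l :=
  qfac s l * fallprod s t l / (qfac q l * qfac (t * q) l)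
  * (qfac q (2 * l) / qfac (s ^+ 2) (2 * l)).

(* even_rogers b z (l - 1), extended by 0 at l = 0. *)
Definition even_rogers_pred b z l :=
  z * z^-1 ^+ l * shift (shift (rogers b z)) (2 * l).

(* Remainder of the telescoping in wp_partial_shift. *)
Definition wp_rest z s t l :=
  wp_weight s t l *
  ((1 - t * s) / (1 - s * q ^+ (2 * l)) *
     ((t - s * q ^+ l) * (1 - s * q ^+ l) * even_rogers_pred (s * q) z l
      - (1 - q ^+ l) * (1 - t * q ^+ l) * even_rogers (s * q) z l)
   + s * ((1 - t * z) * (1 - t * z^-1)) * even_rogers_pred (s * q) z l).

(** The reversal j -> 2l - j exchanges z and z^-1. *)
Lemma even_rogersV b z l : z != 0 -> even_rogers b z^-1 l = even_rogers b z l.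
Proof.
move=> z0; rewrite /even_rogers invrK /rogers !mulr_sumr (reindex_inj rev_ord_inj) /=.
apply: eq_bigr => j _; rewrite subSS; have jl : (j <= 2 * l)%N by rewrite -ltnS.
have e : z ^+ l * z^-1 ^+ (2 * l - j) = z^-1 ^+ l * z ^+ j.
  apply: (mulfI (expf_neq0 l z0)); rewrite [RHS]mulrA -exprMn divff // expr1n mul1r.
  rewrite mulrA -exprD addnn -mul2n -{1}(subnK jl) exprD mulrAC -exprMn divff //.
  by rewrite expr1n mul1r.
by rewrite subKn // [LHS]mulrCA e [RHS]mulrCA; congr (_ * _); rewrite mulrC.
Qed.

Lemma even_rogers_predS b z l : z != 0 ->
  even_rogers_pred b z l.+1 = even_rogers b z l.
Proof.
by move=> z0; rewrite /even_rogers_pred mulnS /= exprS mulrA divff // mul1r.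
Qed.

Lemma qfac_unit a n : (forall i, 1 - a * q ^+ i != 0) -> qfac a n != 0.
Proof.
by move=> h; rewrite /qfac prodf_seq_neq0; apply/allP => i _ /=.
Qed.

(** * Telescoping at n = 0 *)

Section Step.
Variables (z s t : K).
Hypothesis z0 : z != 0.
Hypothesis s1 : forall i, 1 - s * q ^+ i != 0.
Hypothesis ss1 : forall i, 1 - s ^+ 2 * q ^+ i != 0.
Hypothesis t1 : forall i, 1 - t * q ^+ i != 0.

Let s1D i : 1 + s * q ^+ i != 0.
Proof.
have := ss1 (i * 2); rewrite exprM -exprMn -{1}[1](expr1n _ 2) subr_sqr.
by rewrite mulf_eq0 negb_or => /andP[].
Qed.

Let denoms l Q : Q = q ^+ l ->
  [/\ 1 - (s * Q) ^+ 2 != 0, 1 - s ^+ 2 * q * Q ^+ 2 != 0, 1 - t * q * Q != 0,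
     1 + s * Q != 0 & 1 - s * Q != 0].
Proof.
move=> ->; split; [have := ss1 (l * 2) | have := ss1 (l * 2).+1 | have := t1 l.+1
  | exact: s1D | exact: s1].
- by rewrite exprM exprMn.
- by rewrite (exprS q) exprM mulrA.
- by rewrite exprS mulrA.
Qed.

(** [rogers_lower] at index 2l trades the factor (1 - s q^(2l)) / (1 - s) for polynomials of
    parameter sq. *)
Lemma wp_term0E l : wp_term z 0 s t l
  = wp_weight s t l * (even_rogers (s * q) z l - s * even_rogers_pred (s * q) z l).
Proof.
have E := rogers_lower s z (2 * l).
have s0 : 1 - s != 0 by have := s1 0; rewrite expr0 mulr1.
rewrite /wp_term /wp_weight addn0 subn0 /even_rogers /even_rogers_pred.
have -> : rogers s z (2 * l) = (1 - s) / (1 - s * q ^+ (2 * l)) *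
  (rogers (s * q) z (2 * l) - s * z * shift (shift (rogers (s * q) z)) (2 * l)).
  apply: (mulfI (s1 (2 * l))); rewrite E.
  by have := s1 (2 * l); move: (1 - s * _) => u u0; field.
have := s1 (2 * l); move: (1 - s * _) => u u0.
move: (_ / (qfac q l * _)) (_ / qfac (s ^+ 2) _) => A B.
by field; rewrite u0 s0.
Qed.

Let ss2 : 1 - s ^+ 2 != 0.
Proof. by have := ss1 0; rewrite expr0 mulr1. Qed.

Lemma wp_weightS l (Q := q ^+ l) : wp_weight s t l.+1 =
  wp_weight s t l * ((1 - q * Q ^+ 2) * (1 + q * Q) * (t - s * Q)
    / ((1 + s * Q) * (1 - s ^+ 2 * q * Q ^+ 2) * (1 - t * q * Q))).
Proof.
have Q2 : q ^+ (2 * l) = Q ^+ 2 by rewrite mulnC exprM.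
have [h1 h2 h3 h4 h5] := denoms (erefl Q).
rewrite /wp_weight mulnS !qfacS fallprodS !(exprS q) Q2 -/Q.
have h7 : qfac (t * q) l != 0.
  by apply: qfac_unit => i; rewrite -mulrA -exprS.
have h8 := qfac_unit (2 * l) ss1; have h9 := qfac_neq0 l.
have := q1 l; rewrite exprS -/Q => h6.
move: (qfac (t * q) l) (qfac (s ^+ 2) _) (qfac q l) h7 h8 h9.
move: (qfac s l) (qfac q (2 * l)) (fallprod _ _ _).
move=> A1 A2 A3 A4 A5 A6 h7 h8 h9.
by field; rewrite h1 h2 h3 h4 h6 h7 h8 h9.
Qed.

(** Certificate of the telescoping: the first part on the right is a term of the series at (s, t),
    the second a multiple of one at (sq, tq). [rogers_two_step] removes the index 2l + 2, after
    which the coefficients of the two remaining polynomials agree as rational functions. *)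
Lemma wp_restS l (Q := q ^+ l) :
  wp_rest z s t l.+1 - wp_rest z s t l
  = wp_weight s t l * ((1 - t * z) * (1 - t * z^-1) *
      (even_rogers (s * q) z l - s * even_rogers_pred (s * q) z l)
    - (1 - s * z) * (1 - s * z^-1) *
      ((1 + t) * (1 - t ^+ 2 * q) * Q * (1 - s * q * Q ^+ 2)
        / ((1 + s * Q) * (1 - s ^+ 2 * q * Q ^+ 2) * (1 - t * q * Q)))
      * even_rogers (s * q) z l).
Proof.
have Q2 : q ^+ (2 * l) = Q ^+ 2 by rewrite mulnC exprM.
rewrite /wp_rest wp_weightS even_rogers_predS //.
have E := rogers_two_step s z (2 * l).
have [h1 h2 h3 h4 h5] := denoms (erefl Q).
have h6 := q1 (2 * l); have h7 := q1 (2 * l).+1.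
have h8 := s1 (2 * l); have h9 := s1 (2 * l).+2.
move: E h6 h7 h8 h9.
rewrite /even_rogers /even_rogers_pred mulnS !addSn add0n !(exprS q) !(exprS z^-1) Q2 -/Q.
rewrite !expr0 !mulr1; move: (wp_weight s t l) (z^-1 ^+ l).
move: (rogers (s * q) z (2 * l).+2) (rogers (s * q) z (2 * l)) (shift _ (2 * l)).
move=> x2 x u w y E h6 h7 h8 h9.
(* Dividing by the leading coefficient solves [E] for the polynomial of index 2l + 2. *)
have -> : x2 = ((1 - s * Q ^+ 2) * ((1 - q * Q ^+ 2) * (1 - q * q * Q ^+ 2)))^-1 *
  ((1 - s * Q ^+ 2) * ((1 - q * Q ^+ 2) * (1 - q * q * Q ^+ 2)) * x2).
  by rewrite mulKf // !mulf_neq0 // -mulrA.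
rewrite E; field; rewrite h2 h3 h4 h6 h8 h9 z0 /= andbT.
by rewrite -[q * q * _]mulrA.
Qed.

Let s2 : 1 - s != 0.
Proof. by have := s1 0; rewrite expr0 mulr1. Qed.

(** The rational factor is that of [wp_restS]; each [qfac] at shifted parameters differs from the
    unshifted one only by factors at its two ends. *)
Lemma wp_term0_shift l (Q := q ^+ l) :
  (1 - t ^+ 2) * (1 - t ^+ 2 * q) * ((1 - s) * (1 - s * q))
    * wp_term z 0 (s * q) (t * q) l
  = (1 - t) * (1 - t * q) * ((1 - s ^+ 2) * (1 - s ^+ 2 * q))
    * (wp_weight s t l *
      ((1 + t) * (1 - t ^+ 2 * q) * Q * (1 - s * q * Q ^+ 2)
        / ((1 + s * Q) * (1 - s ^+ 2 * q * Q ^+ 2) * (1 - t * q * Q)))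
      * even_rogers (s * q) z l).
Proof.
have Q2 : q ^+ (2 * l) = Q ^+ 2 by rewrite mulnC exprM.
have [h1 h2 h3 h4 h5] := denoms (erefl Q).
rewrite /wp_term /wp_weight addn0 subn0 fallprodM Q2 -/Q.
have e1 := qfac_recl s l; rewrite qfacS -/Q in e1.
have e2 := qfac_recl (t * q) l; rewrite qfacS -/Q in e2.
have e3 : qfac (s ^+ 2) (2 * l) * (1 - s ^+ 2 * Q ^+ 2) * (1 - s ^+ 2 * (q * Q ^+ 2))
    = (1 - s ^+ 2) * ((1 - s ^+ 2 * q) * qfac (s ^+ 2 * q * q) (2 * l)).
  by rewrite -!qfac_recl !qfacS (exprS q) Q2.
have -> : (s * q) ^+ 2 = s ^+ 2 * q * q by rewrite exprMn expr2 !mulrA.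
have h6 : 1 - s * q != 0 by have := s1 1; rewrite expr1.
have h7 : 1 - t * q != 0 by have := t1 1; rewrite expr1.
have h8 : 1 - s ^+ 2 * q != 0 by have := ss1 1; rewrite expr1.
have n1 : qfac (t * q) l != 0 by apply: qfac_unit => i; rewrite -mulrA -exprS.
have n2 := qfac_unit (2 * l) ss1; have n3 := qfac_neq0 l.
have -> : qfac (s * q) l = qfac s l * (1 - s * Q) / (1 - s).
  by rewrite e1 [RHS]mulrC mulKf.
have -> : qfac (t * q * q) l = qfac (t * q) l * (1 - t * q * Q) / (1 - t * q).
  by rewrite e2 [RHS]mulrC mulKf.
have -> : qfac (s ^+ 2 * q * q) (2 * l) = qfac (s ^+ 2) (2 * l) *
  (1 - s ^+ 2 * Q ^+ 2) * (1 - s ^+ 2 * (q * Q ^+ 2))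
  / ((1 - s ^+ 2) * (1 - s ^+ 2 * q)).
  by rewrite e3 mulrA [RHS]mulrC mulKf // mulf_neq0.
move: (qfac (t * q) l) (qfac (s ^+ 2) _) (qfac q l) n1 n2 n3.
move: (qfac s l) (qfac q (2 * l)) (fallprod _ _ _) (even_rogers _ _ _).
move=> A1 A2 A3 A7 A4 A5 A6 n1 n2 n3.
by field; rewrite h1 h2 h3 h4 h6 h7 h8 n1 n2 n3 s2 ss2.
Qed.

Lemma wp_partial_shift N :
  (1 - t) * (1 - t * q) * ((1 - s ^+ 2) * (1 - s ^+ 2 * q))
    * ((1 - t * z) * (1 - t * z^-1) * \sum_(0 <= l < N) wp_term z 0 s t l)
  = (1 - t ^+ 2) * (1 - t ^+ 2 * q) * ((1 - s) * (1 - s * q))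
    * ((1 - s * z) * (1 - s * z^-1)
      * \sum_(0 <= l < N) wp_term z 0 (s * q) (t * q) l)
    + (1 - t) * (1 - t * q) * ((1 - s ^+ 2) * (1 - s ^+ 2 * q)) * wp_rest z s t N.
Proof.
elim: N => [|N IH].
  (* The remainder vanishes at 0: [even_rogers_pred] is 0 there and the other polynomial carries 1 -
     q^0. *)
  rewrite !big_nil /wp_rest /even_rogers_pred muln0 /= expr0 subrr.
  by rewrite !(mulr0, mul0r, addr0, subrr).
rewrite !big_nat_recr //=.
have E1 := wp_term0_shift N; have E2 := wp_restS N; have E3 := wp_term0E N.
rewrite E3; move: IH E1 E2; set S := \sum_(_ <= l < _) _; set S' := \sum_(_ <= l < _) _.
move: (wp_rest z s t N.+1) (wp_rest z s t N) S S' => r1 r0 S S'.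
move: (wp_term z 0 (s * q) (t * q) N) => T.
cbv zeta; move: (_ / ((1 + s * q ^+ N) * _ * _)) (wp_weight s t N) => X w IH E1 E2.
apply: (eq_of_subr (congr2 +%R IH
  (congr2 +%R (congr1 ( *%R (- ((1 - s * z) * (1 - s * z^-1)))) E1)
    (congr1 ( *%R (- ((1 - t) * (1 - t * q) * ((1 - s ^+ 2) * (1 - s ^+ 2 * q))))) E2)))).
ring.
Qed.

End Step.

(** * Passage from n to n + 1 *)

Lemma fallprod_shift s t n :
  fallprod s (t * q) n.+1 = (t * q - s) * q ^+ n * fallprod s t n.
Proof.
elim: n => [|n IH]; first by rewrite fallprodS !fallprod0 expr0; ring.
by rewrite fallprodS IH fallprodS !exprS; ring.
Qed.

Definition wp_sum z n s t N := \sum_(n <= l < N) wp_term z n s t l.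

Section NStep.
Variables (z s t : K).
Hypothesis z0 : z != 0.
Hypothesis t1 : forall i, 1 - t * q ^+ i != 0.
Hypothesis tt1 : forall i, 1 - t ^+ 2 * q ^+ i != 0.

Let tq1 : 1 - t * q != 0.
Proof. by have := t1 1; rewrite expr1. Qed.

Let qfac_tqq m : qfac (t * q * q) m = qfac (t * q) m * (1 - t * q * q ^+ m) / (1 - t * q).
Proof. by rewrite -qfacS qfac_recl [RHS]mulrC mulKf. Qed.

Let qfac_tq_neq0 m : qfac (t * q) m != 0.
Proof. by apply: qfac_unit => i; rewrite -mulrA -exprS. Qed.

(** Writing l = n + 1 + i turns l - n and l - (n + 1) into i + 1 and i; the three terms then share
    all but a few linear factors. *)
Lemma wp_term_nshift n i (l := (n.+1 + i)%N) :
  wp_term z n s t l - t * wp_term z n.+1 s t l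
  = (1 - t * q ^+ (2 * n).+1) / (1 - t * q) * wp_term z n s (t * q) l.
Proof.
rewrite /wp_term.
have -> : (l - n)%N = i.+1 by rewrite /l addSn -addnS addKn.
have -> : (l - n.+1)%N = i by rewrite /l addKn.
rewrite addnS fallprod_shift (fallprodS s t i) (qfacS s (l + n)).
rewrite (qfacS (t * q) (l + n)) (qfacS q i) qfac_tqq -(exprS q).
have -> : q ^+ (l + n) = q ^+ (2 * n).+1 * q ^+ i.
  by rewrite -exprD; congr (_ ^+ _); rewrite /l mul2n -addnn !addSn addnAC.
have h1 : 1 - t * q * (q ^+ (2 * n).+1 * q ^+ i) != 0.
  by rewrite -mulrA -exprD -exprS.
have := q1 i; rewrite exprS => h2.
have n1 := qfac_tq_neq0 (l + n); have n3 := qfac_neq0 i.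
move: (qfac (t * q) _) (qfac q i) n1 n3 h1.
move: (qfac s _) (fallprod s t i) (q ^+ i) h2 => A1 A2 I.
move: (even_rogers s z l) (_ / (1 - s) * _) (q ^+ (2 * n).+1) => A3 A4 X.
move=> h2 A5 A6 n1 n3 h1.
by field; rewrite tq1 h1 h2 n1 n3.
Qed.

Lemma wp_sum_nshift n N : wp_sum z n s t N - t * wp_sum z n.+1 s t N
  = (1 - t * q ^+ (2 * n).+1) / (1 - t * q) * wp_sum z n s (t * q) N.
Proof.
rewrite /wp_sum; have [Nn|nN] := leqP N n.
  by rewrite !big_geq ?(leq_trans Nn) // !mulr0 subr0.
rewrite ![\sum_(n <= l < N) _]big_ltn // mulrDr -addrA.
congr (_ + _).
  (* At l = n the sum for n + 1 has no term yet, and [fallprod] is an empty product. *)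
  rewrite /wp_term subnn !fallprod0 qfac_tqq.
  have n1 := qfac_tq_neq0 (n + n); have n3 := qfac_neq0 0.
  have := t1 (2 * n).+1; rewrite (exprS q (2 * n)) mulrA => h1.
  rewrite (_ : (n + n)%N = (2 * n)%N) in n1 *; last by rewrite mul2n addnn.
  move: (_ / (1 - s) * _) (qfac s _) (even_rogers s z n) => A1 A2 A3.
  move: (qfac (t * q) _) (qfac q 0) (q ^+ (2 * n)) n1 n3 h1 => A4 A5 X n1 n3 h1.
  by field; rewrite tq1 h1 n1 n3.
rewrite !mulr_sumr -sumrB; apply: eq_big_nat => l /andP[nl _].
by rewrite -(subnKC nl) wp_term_nshift.
Qed.

(** The factor of the closed form that depends on n, apart from t^n. *)
Definition wp_value z t n :=
  qfac q (2 * n) / qfac (t ^+ 2) (2 * n) * even_rogers t z n.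

(** This is [rogers_raise] with b = t and m = 2n, after division by the factors that extend
    [qfac (t ^+ 2)] by two steps. *)
Lemma wp_value_nshift n : wp_value z t n - t * wp_value z t n.+1
  = (1 - t * q ^+ (2 * n).+1) * (1 - t) * ((1 - t * z) * (1 - t * z^-1))
    / ((1 - t ^+ 2) * (1 - t ^+ 2 * q)) * wp_value z (t * q) n.
Proof.
have := rogers_raise t (2 * n) z0.
rewrite /wp_value /even_rogers mulnS !addSn add0n !qfacS.
have h0 : 1 - t ^+ 2 != 0 by have := tt1 0; rewrite expr0 mulr1.
have h1 : 1 - t ^+ 2 * q != 0 by have := tt1 1; rewrite expr1.
have -> : qfac ((t * q) ^+ 2) (2 * n) = qfac (t ^+ 2) (2 * n) *
   (1 - t ^+ 2 * q ^+ (2 * n)) * (1 - t ^+ 2 * q ^+ (2 * n).+1)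
   / ((1 - t ^+ 2) * (1 - t ^+ 2 * q)).
  rewrite -!qfacS !qfac_recl mulrA [RHS]mulrC mulKf ?mulf_neq0 //.
  by congr (qfac _ _); ring.
have h2 := tt1 (2 * n); have h3 := tt1 (2 * n).+1.
have h4 := q1 (2 * n); have h5 := q1 (2 * n).+1.
have h6 := qfac_unit (2 * n) tt1.
rewrite -!exprS.
move: (qfac (t ^+ 2) _) (qfac q _) (rogers _ _ _) (rogers _ _ _) (rogers _ _ _) h6.
rewrite (exprS z^-1).
move=> A1 A2 A3 A4 A5 h6.
move: (1 - t ^+ 2 * q ^+ (2 * n)) (1 - t ^+ 2 * q ^+ (2 * n).+1) h2 h3.
move: (1 - q ^+ (2 * n).+1) (1 - q ^+ (2 * n).+2) (_ * ((1 - t * z) * _)).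
move: z^-1 (z^-1 ^+ n) => zi y e1 e2 Y d1 d2 h2 h3 E.
transitivity (Y * A3 * (A2 / (A1 * d1 * d2) * y)); last first.
  by field; rewrite h0 h1 h2 h3 h6.
by rewrite -E; field; rewrite h2 h3 h6.
Qed.
End NStep.
End Rogers.

(** * Completeness and product bounds over R and R[i] *)

Definition geo_complete (C : numFieldType) :=
  forall (u : nat -> C) (K r : C), 0 <= r -> r < 1 ->
  (forall n, `|u n| <= K * r ^+ n) -> cvgn (series u).

(** Like [geo_complete], a property of the field that is assumed over a general [numFieldType] and
    proved for R and R[i]. *)
Definition geo_prod_bounded (C : numFieldType) :=
  forall x r : C, 0 <= x -> 0 <= r -> r < 1 ->
  exists K : C, forall n, \prod_(i < n) (1 + x * r ^+ i) <= K.

Lemma sum_expr_le (C : numFieldType) (r : C) n :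
  0 <= r -> r < 1 -> \sum_(i < n) r ^+ i <= (1 - r)^-1.
Proof.
move=> r0 r1; have r1' : 0 < 1 - r by rewrite subr_gt0.
rewrite -(ler_pM2l r1') divff ?gt_eqF // -opprB mulNr -subrX1 opprB.
by rewrite gerBl exprn_ge0.
Qed.

(** 1 + y <= exp y bounds the product by the exponential of a geometric sum. *)
Lemma real_geo_prod_bounded (R : realType) : geo_prod_bounded R.
Proof.
move=> x r x0 r0 r1; exists (expR (x / (1 - r))) => n.
apply: (@le_trans _ _ (expR (\sum_(i < n) x * r ^+ i))).
  elim: n => [|n IH]; first by rewrite !big_ord0 expR0.
  rewrite !big_ord_recr /= expRD ler_pM ?expR_ge1Dx //.
    by apply: prodr_ge0 => i _; rewrite addr_ge0 // mulr_ge0 // exprn_ge0.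
  by rewrite addr_ge0 // mulr_ge0 // exprn_ge0.
by rewrite ler_expR -mulr_sumr ler_wpM2l // sum_expr_le.
Qed.

Lemma complex_ge0P (R : realType) (x : R[i]) : 0 <= x -> exists2 k : R, 0 <= k & x = k%:C.
Proof.
move=> x0; have /complex_realP[k xk] := ger0_real x0.
by exists k => //; move: x0; rewrite xk ler0c.
Qed.

(** In the order of R[i] a nonnegative element is real, which reduces the claim to R. *)
Lemma complex_geo_prod_bounded (R : realType) : geo_prod_bounded R[i].
Proof.
move=> _ _ /complex_ge0P[x x0 ->] /complex_ge0P[r r0 ->]; rewrite -[1]/(1%:C) ltcR => r1.
have [K hK] := real_geo_prod_bounded x0 r0 r1; exists K%:C => n.
apply: le_trans (_ : (\prod_(i < n) (1 + x * r ^+ i))%:C <= _); last by rewrite lecR.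
by rewrite rmorph_prod; under eq_bigr => i _ do rewrite rmorphD rmorphM rmorphXn /=.
Qed.

Lemma real_geo_complete (R : realType) : geo_complete R.
Proof.
move=> u K r r0 r1 hu; apply: normed_cvg.
have K0 : 0 <= K by have := hu 0; rewrite expr0 mulr1; apply: le_trans.
apply: (@series_le_cvg _ _ (geometric K r)).
- by move=> n; rewrite normr_ge0.
- by move=> n; rewrite mulr_ge0 // exprn_ge0.
- exact: hu.
- by apply: is_cvg_geometric_series; rewrite ger0_norm.
Qed.

(** Real and imaginary parts converge by the real case, and their limits are assembled. *)
Lemma complex_geo_complete (R : realType) : geo_complete R[i].
Proof.
move=> u _K _r /complex_ge0P[r r0 ->]; rewrite -[1]/(1%:C) ltcR => r1 hu.
have [K K0 KE] : exists2 K : R, 0 <= K & _K = K%:C.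
  by apply: complex_ge0P; have := hu 0; rewrite expr0 mulr1; apply: le_trans.
have {}hu n : `|u n| <= (K * r ^+ n)%:C by rewrite rmorphM rmorphXn /= -KE.
have Reu : cvgn (series (fun n => complex.Re (u n))).
  apply: (real_geo_complete r0 r1) => n.
  by rewrite -lecR; apply: le_trans (normc_ge_Re _) (hu n).
have Imu : cvgn (series (fun n => complex.Im (u n))).
  apply: (real_geo_complete r0 r1) => n.
  (* Im x = - Re (x i) and |i| = 1, so the bound on real parts applies. *)
  rewrite -lecR -[complex.Im _]opprK -ReiNIm normrN.
  apply: le_trans (normc_ge_Re _) _; rewrite normrM (_ : `|'i| = 1) ?mulr1 //.
  by rewrite normc_def /= expr0n expr1n add0r sqrtr1.
set a := limn _ in Reu; set b := limn _ in Imu.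
apply/cvg_ex; exists (a +i* b : R[i]); apply/cvgrPdist_lt => _e e0.
have [e _ eE] := complex_ge0P (ltW e0).
have {}e0 : 0 < e / 2 by move: e0; rewrite eE (ltcR 0) => ?; rewrite divr_gt0.
have /cvgrPdist_lt/(_ _ e0) Ha := Reu.
have /cvgrPdist_lt/(_ _ e0) Hb := Imu.
near=> n.
have -> : series u n = series (fun n => complex.Re (u n)) n
    +i* series (fun n => complex.Im (u n)) n.
  apply/eqP; rewrite eq_complex /series /=.
  by rewrite (raddf_sum (@complex.Re R)) (raddf_sum (@complex.Im R)) !eqxx.
have -> : a +i* b - (series (fun n => complex.Re (u n)) n
    +i* series (fun n => complex.Im (u n)) n)
  = (a - series (fun n => complex.Re (u n)) n)%:C
    + 'i * (b - series (fun n => complex.Im (u n)) n)%:C.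
  by apply/eqP; rewrite eq_complex /= !(mul0r, mul1r, mulr0, addr0, add0r, subr0) !eqxx.
apply: le_lt_trans (ler_normD _ _) _.
rewrite normrM (_ : `|'i| = 1) ?mul1r; last first.
  by rewrite normc_def /= expr0n expr1n add0r sqrtr1.
rewrite !normc_def /= !expr0n !addr0 !sqrtr_sqr -rmorphD /= eE ltcR [e]splitr.
by rewrite ltrD //; [near: n; exact: Ha | near: n; exact: Hb].
Unshelve. all: by end_near.
Qed.

(** * Estimates in a numeric field *)

Section NumField.
Variable C : numFieldType.
Implicit Types (a b s t x z K r : C) (u v : nat -> C).

Lemma norm_mul_le a b (A B : C) : `|a| <= A -> `|b| <= B -> `|a * b| <= A * B.
Proof. by move=> ha hb; rewrite normrM ler_pM. Qed.

Lemma norm_add_le a b (A B : C) : `|a| <= A -> `|b| <= B -> `|a + b| <= A + B.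
Proof. by move=> ha hb; apply: le_trans (ler_normD _ _) (lerD ha hb). Qed.

Lemma norm_sub_le a b (A B : C) : `|a| <= A -> `|b| <= B -> `|a - b| <= A + B.
Proof. by move=> ha hb; apply: norm_add_le; rewrite ?normrN. Qed.

Lemma norm_sub1_le2 a : `|a| <= 1 -> `|1 - a| <= 2.
Proof. by move=> ha; apply: (@norm_sub_le 1 a 1 1) => //; rewrite normr1. Qed.

Lemma norm_le_cvg0 u v :
  (forall n, `|u n| <= v n) -> v n @[n --> \oo] --> 0 -> u n @[n --> \oo] --> 0.
Proof.
move=> uv /cvgrPdist_lt v0; apply/cvgrPdist_lt => e e0.
have := v0 e e0; apply: filterS => n; rewrite !sub0r !normrN.
apply: le_lt_trans; apply: le_trans (uv n) _.
by rewrite ger0_norm //; apply: le_trans (uv n).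
Qed.

Lemma cvgn_unique u a b :
  u n @[n --> \oo] --> a -> u n @[n --> \oo] --> b -> a = b.
Proof.
have H : hausdorff_space C by exact: norm_hausdorff.
by move=> /(cvg_lim H) <- /(cvg_lim H) <-.
Qed.

Lemma cvg_norm_le u a b K : u n @[n --> \oo] --> a ->
  (forall n, `|u n - b| <= K) -> `|a - b| <= K.
Proof.
move=> ua uK; have K0 : 0 <= K by apply: le_trans (uK 0%N).
(* The order on C is partial, but both sides are nonnegative and hence comparable. *)
rewrite real_leNgt ?ger0_real //; apply/negP => lt.
have e0 : 0 < `|a - b| - K by rewrite subr_gt0.
have /cvgrPdist_lt/(_ _ e0)[N _ /(_ N (leqnn N)) h] := ua.
have : `|a - b| < `|a - b| - K + K.
  rewrite -{1}[a - b](subrKA (u N)); apply: le_lt_trans (ler_normD _ _) _.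
  exact: ltr_leD h (uK N).
by rewrite subrK ltxx.
Qed.

(** Source of the geometric decay of the terms: x will be |t| M, and 2n + 1 counts the summands of
    the polynomial of index 2n. *)
Lemma prod_tail_bound (Hp : geo_prod_bounded C) x y r : 
  0 <= x -> x < 1 -> 0 <= y -> 0 <= r -> r < 1 ->
  exists K : C, exists2 r' : C, [/\ 0 <= K, 0 <= r' & r' < 1] &
    forall n, (2 * n + 1)%:R * \prod_(i < n) (x + y * r ^+ i) <= K * r' ^+ n.
Proof.
move=> x0 x1 y0 r0 r1.
(* Midpoints x < r2 < r3 < 1: x + y r^i <= r2 (1 + (y / r2) r^i) bounds the product by a multiple of
   r2^n, and the gap from [r2] to [r3] absorbs 2n + 1. *)
pose r2 := (x + 1) / 2; pose r3 := (r2 + 1) / 2.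
have [/= xr2 r21] := midf_lt x1; rewrite -/r2 in xr2 r21.
have [/= r23 r31] := midf_lt r21; rewrite -/r3 in r23 r31.
have r2p : 0 < r2 by apply: le_lt_trans xr2.
have r3p : 0 < r3 by apply: lt_trans r23.
have [K hK] := Hp (y / r2) r (divr_ge0 y0 (ltW r2p)) r0 r1.
have K0 : 0 <= K by have := hK 0%N; rewrite big_ord0; apply: le_trans.
pose w := r2 / r3.
have w0 : 0 <= w by rewrite divr_ge0 // ltW.
have w1 : w < 1 by rewrite ltr_pdivrMr // mul1r.
exists (2 * (1 - w)^-1 * K), r3; first split.
- by rewrite !mulr_ge0 // invr_ge0 subr_ge0 ltW.
- exact: ltW.
- exact: r31.
move=> n.
have h1 : \prod_(i < n) (x + y * r ^+ i) <= K * r2 ^+ n.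
  apply: (@le_trans _ _ (\prod_(i < n) (r2 * (1 + y / r2 * r ^+ i)))).
    apply: ler_prod => i _; rewrite addr_ge0 ?mulr_ge0 ?exprn_ge0 //=.
    rewrite mulrDr mulr1 mulrA [r2 * _]mulrC divfK ?gt_eqF // lerD2r; exact: ltW.
  rewrite big_split /= prodr_const card_ord mulrC.
  by apply: ler_wpM2r (hK n); rewrite exprn_ge0 // ltW.
apply: (@le_trans _ _ ((2 * n + 1)%:R * (K * r2 ^+ n))).
  by rewrite ler_wpM2l.
have -> : r2 = w * r3 by rewrite divfK ?gt_eqF.
rewrite exprMn mulrA mulrA ler_wpM2r ?exprn_ge0 ?(ltW r3p) //.
rewrite mulrAC ler_wpM2r //.
(* (2n + 1) w^n <= 2 (n + 1) w^n <= 2 (1 + w + ... + w^n), since w < 1. *)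
apply: (@le_trans _ _ (2 * \sum_(i < n.+1) w ^+ i)); last first.
  by rewrite ler_wpM2l // sum_expr_le.
apply: (@le_trans _ _ (2 * \sum_(i < n.+1) w ^+ n)).
  rewrite sumr_const card_ord -[w ^+ n *+ _]mulr_natl mulrA.
  by rewrite ler_wpM2r ?exprn_ge0 // -natrM ler_nat mulnS addnC leq_add2r.
rewrite ler_wpM2l //; apply: ler_sum => i _; rewrite ler_wiXn2l // ?(ltW w1) //.
by rewrite -ltnS.
Qed.

End NumField.

(** * Bounds and convergence of q-Pochhammer products *)

Section QPochhammer.
Variables (C : numFieldType) (q : C).
Hypotheses (Hp : geo_prod_bounded C) (Hc : geo_complete C) (hq : `|q| < 1).
Implicit Types (a b s t x z : C).

Lemma norm_mulX_le a n : `|a * q ^+ n| <= `|a|.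
Proof.
by rewrite normrM normrX ler_piMr // exprn_ile1 // ltW.
Qed.

Lemma sub1_mulX_neq0 a n : `|a| < 1 -> 1 - a * q ^+ n != 0.
Proof.
move=> a1; rewrite subr_eq0 eq_sym; apply: contraTneq a1 => e.
rewrite -real_leNgt ?normr_real ?real1 //.
by have := norm_mulX_le a n; rewrite e normr1.
Qed.

Lemma sub1_X_neq0 n : 1 - q ^+ n.+1 != 0.
Proof. by rewrite exprS sub1_mulX_neq0. Qed.

(** A [numFieldType] need not be archimedean, so this rests on [geo_complete]: the powers are the
    terms of a convergent series. *)
Lemma expr_cvg0 x : `|x| < 1 -> x ^+ n @[n --> \oo] --> 0.
Proof.
move=> x1; apply: cvg_series_cvg_0; apply: (@Hc _ 1 _ (normr_ge0 x) x1) => n.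
by rewrite normrX mul1r.
Qed.

Lemma qfac_ub (r : C) : 0 <= r ->
  exists2 K : C, 0 <= K & forall a n, `|a| <= r -> `|qfac q a n| <= K.
Proof.
move=> r0; have [K hK] := Hp r0 (normr_ge0 q) hq; exists K => [|a n ar].
  by have := hK 0%N; rewrite big_ord0; apply: le_trans.
apply: le_trans (hK n); rewrite normr_prod; apply: ler_prod => i _.
rewrite normr_ge0 /=; apply: norm_sub_le; rewrite ?normr1 //.
by rewrite normrM normrX ler_wpM2r // exprn_ge0.
Qed.

Lemma qfac_bounds (r : C) : 0 <= r -> r < 1 ->
  exists2 K : C, 0 <= K & forall a n, `|a| <= r ->
    `|qfac q a n| <= K /\ `|(qfac q a n)^-1| <= K.
Proof.
move=> r0 r1; have [K1 K10 h1] := qfac_ub r0.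
have r1' : 0 < 1 - r by rewrite subr_gt0.
(* With e = r |q|^i <= r, 1 / (1 - e) = 1 + e / (1 - e) <= 1 + (r / (1 - r)) |q|^i. *)
have [K2 h2] := Hp (divr_ge0 r0 (ltW r1')) (normr_ge0 q) hq.
have K20 : 0 <= K2 by have := h2 0%N; rewrite big_ord0; apply: le_trans.
exists (K1 + K2) => [|a n ar]; first exact: addr_ge0.
split; first by apply: le_trans (h1 a n ar) _; rewrite lerDl.
apply: (@le_trans _ _ K2); last by rewrite lerDr.
apply: le_trans (h2 n); rewrite normfV normr_prod -prodfV; apply: ler_prod => i _.
rewrite invr_ge0 normr_ge0 /=.
have hi : `|a * q ^+ i| <= r * `|q| ^+ i.
  by rewrite normrM normrX ler_wpM2r // exprn_ge0.
have qi : `|q| ^+ i <= 1 by rewrite exprn_ile1 // ltW.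
have rq : r * `|q| ^+ i <= r by rewrite ler_piMr.
have pos : 0 < 1 - r * `|q| ^+ i by rewrite subr_gt0; apply: le_lt_trans r1.
have lb : 1 - r * `|q| ^+ i <= `|1 - a * q ^+ i|.
  apply: le_trans (lerB_dist _ _); rewrite normr1 lerD2l lerN2 //.
apply: (@le_trans _ _ (1 - r * `|q| ^+ i)^-1).
  by rewrite lef_pV2 // posrE // (lt_le_trans pos).
rewrite -(ler_pM2l pos) divff ?gt_eqF // mulrDr mulr1.
set e := r * `|q| ^+ i in pos rq *.
have -> : r / (1 - r) * `|q| ^+ i = e / (1 - r) by rewrite mulrAC.
have : e <= (1 - e) * (e / (1 - r)).
  rewrite mulrCA -[leLHS]mulr1 ler_wpM2l ?mulr_ge0 ?exprn_ge0 //.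
  by rewrite ler_pdivlMr // mul1r lerD2l lerN2.
by rewrite -(lerD2l (1 - e)) subrK.
Qed.

(** The increments -(a q^n) [qfac q a n] of the partial products have a geometric majorant, so the
    product becomes a convergent series. *)
Lemma qfac_cvg a : qfac q a n @[n --> \oo] --> qpoch_inf a q.
Proof.
have E n : qfac q a n = \prod_(0 <= k < n) (1 - a * q ^+ k) by rewrite big_mkord.
have [K K0 hK] := qfac_ub (normr_ge0 a).
pose f : nat -> C := qfac q a.
suff h : cvgn f.
  suff -> : qpoch_inf a q = limn f by exact: h.
  have e : (fun N => \prod_(0 <= k < N) (1 - a * q ^+ k)) = f.
    by apply/funext => n; rewrite /f E.
  by rewrite /qpoch_inf e.
have cs : cvgn (series (fun n => - (a * q ^+ n) * qfac q a n)).
  apply: (@Hc _ (`|a| * K) _ (normr_ge0 q) hq) => n.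
  rewrite normrM normrN normrM normrX mulrAC ler_wpM2r ?exprn_ge0 //.
  by rewrite ler_wpM2l // hK.
have -> : f = (fun n => 1 + series (fun n => - (a * q ^+ n) * qfac q a n) n).
  apply/funext; elim=> [|n IH]; first by rewrite /f /series /= big_nil qfac0 addr0.
  rewrite /f qfacS seriesS -/(f n) addrCA -IH; ring.
by apply: is_cvgD => //; exact: is_cvg_cst.
Qed.

Lemma qpoch_inf_qfac a n : qpoch_inf a q = qfac q a n * qpoch_inf (a * q ^+ n) q.
Proof.
apply: (cvgn_unique (@qfac_cvg a)); rewrite -(cvg_shiftn n).
rewrite (_ : [sequence _]_n = fun N => qfac q a n * qfac q (a * q ^+ n) N).
  by apply: cvgM; [exact: cvg_cst|exact: (@qfac_cvg _)].
apply/funext => N /=; rewrite /qfac addnC big_split_ord /=; congr (_ * _).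
by apply: eq_bigr => i _; rewrite exprD mulrA.
Qed.

Lemma qpoch_inf_neq0 a : `|a| < 1 -> qpoch_inf a q != 0.
Proof.
move=> a1; have [K K0 hK] := qfac_bounds (normr_ge0 a) a1.
have := @qfac_cvg a; have [->|//] := eqVneq (qpoch_inf a q) 0 => h.
(* A partial product smaller than 1 / (K + 1) contradicts the bound K on its inverse. *)
have e0 : 0 < (K + 1)^-1 by rewrite invr_gt0 ltr_wpDl.
have /cvgrPdist_lt/(_ _ e0)[N _ /(_ N (leqnn N))] := h.
rewrite sub0r normrN; have [_] := hK a N (lexx _).
have u0 : qfac q a N != 0 by apply: qfac_unit => i; exact: sub1_mulX_neq0.
rewrite normfV => h1; rewrite -[ltLHS]invrK ltf_pV2 ?posrE ?invr_gt0 ?normr_gt0 //.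
  by move=> /lt_le_trans/(_ h1); rewrite gtrDl ltr10.
by rewrite ltr_wpDl.
Qed.

Lemma qpochE a n : qpoch_inf (a * q ^+ n) q != 0 -> qpoch a q n = qfac q a n.
Proof. by move=> h; rewrite /qpoch (qpoch_inf_qfac a n) mulfK. Qed.

Lemma qpochE_lt1 a n : `|a| < 1 -> qpoch a q n = qfac q a n.
Proof.
by move=> a1; rewrite qpochE // qpoch_inf_neq0 // (le_lt_trans (norm_mulX_le a n)).
Qed.

End QPochhammer.

(** * Geometric bounds on the terms *)

Section WPBase.
Variables (C : numFieldType) (q : C).
Hypotheses (Hp : geo_prod_bounded C) (Hc : geo_complete C) (hq : `|q| < 1).
Variables (z M : C).
Hypotheses (z0 : z != 0) (M1 : 1 <= M) (zM : `|z| <= M) (zVM : `|z^-1| <= M).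
Implicit Types (a b s t x : C).

Let M0 : 0 <= M. Proof. exact: le_trans M1. Qed.

(** The exponent j - l runs from -l to l, and M bounds 1, |z| and |z^-1|. *)
Lemma norm_laurent_le l j : (j <= 2 * l)%N -> `|z^-1 ^+ l * z ^+ j| <= M ^+ l.
Proof.
have powM a k : `|a| <= M -> (k <= l)%N -> `|a ^+ k| <= M ^+ l.
  move=> aM kl; rewrite normrX; apply: (@le_trans _ _ (M ^+ k)).
    by rewrite lerXn2r.
  by rewrite ler_weXn2l.
move=> jl; have [lj|/ltnW lj] := leqP l j.
  have -> : z ^+ j = z ^+ l * z ^+ (j - l) by rewrite -exprD subnKC.
  rewrite mulrA -exprMn mulVf // expr1n mul1r powM // leq_subLR; lia.
have -> : z^-1 ^+ l = z^-1 ^+ (l - j) * z^-1 ^+ j by rewrite -exprD subnK.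
by rewrite -mulrA -exprMn mulVf // expr1n mulr1 powM // leq_subr.
Qed.

Lemma qratio_bound (r : C) : 0 <= r -> r < 1 ->
  exists2 K : C, 0 <= K & forall b n, `|b| <= r -> `|qratio q b n| <= K.
Proof.
move=> r0 r1; have [K1 K10 h1] := qfac_bounds Hp hq r0 r1.
have [K2 K20 h2] := qfac_bounds Hp hq (normr_ge0 q) hq.
exists (K1 * K2) => [|b n br]; first exact: mulr_ge0.
by apply: norm_mul_le; [have [] := h1 b n br | have [] := h2 q n (lexx _)].
Qed.

Lemma even_rogers_bound (r : C) : 0 <= r -> r < 1 ->
  exists2 K : C, 0 <= K & forall b l, `|b| <= r ->
    `|even_rogers q b z l| <= K * ((2 * l + 1)%:R * M ^+ l).
Proof.
move=> r0 r1; have [K K0 hK] := qratio_bound r0 r1.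
exists (K * K) => [|b l br]; first exact: mulr_ge0.
rewrite /even_rogers /rogers mulr_sumr.
apply: le_trans (ler_norm_sum _ _ _) _.
apply: (@le_trans _ _ (\sum_(j < (2 * l).+1) K * K * M ^+ l)); last first.
  rewrite sumr_const card_ord addn1 -[_ *+ _]mulr_natl.
  by rewrite mulrCA.
apply: ler_sum => j _; rewrite mulrCA; apply: norm_mul_le.
  by apply: norm_mul_le; exact: hK.
by apply: norm_laurent_le; rewrite -ltnS.
Qed.

(** |t - s q^i| M <= |t| M + |s| M |q|^i, so [prod_tail_bound] applies with x = |t| M. The factor
    (2l + 1) M^l is the growth allowed by [even_rogers_bound]. *)
Lemma fallprod_bound s t : `|t| * M < 1 ->
  exists K : C, exists2 r : C, [/\ 0 <= K, 0 <= r & r < 1] & forall l,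
    `|fallprod q s t l| * ((2 * l + 1)%:R * M ^+ l) <= K * r ^+ l.
Proof.
move=> tM; have [K [r Kr hK]] := prod_tail_bound Hp (mulr_ge0 (normr_ge0 t) M0) tM
  (mulr_ge0 (normr_ge0 s) M0) (normr_ge0 q) hq.
exists K, r => // l; apply: le_trans (hK l).
rewrite mulrCA ler_wpM2l // /fallprod normr_prod -[l in M ^+ l]card_ord -prodr_const.
rewrite -big_split /=; apply: ler_prod => i _.
rewrite mulr_ge0 //= mulrAC -mulrDl ler_wpM2r // -normrX -normrM.
by apply: norm_sub_le.
Qed.

(** Uniformity in x serves the iteration, where x = q^k; the factor |x|^l, which comes from
    [fallprodM], makes all terms but l = 0 vanish as x tends to 0. *)
Lemma wp_term_bound s t : `|s| < 1 -> `|t| < 1 -> `|t| * M < 1 ->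
  exists K : C, exists2 r : C, [/\ 0 <= K, 0 <= r & r < 1] & forall x l, `|x| <= 1 ->
    `|wp_term q z 0 (s * x) (t * x) l| <= K * (`|x| ^+ l * r ^+ l).
Proof.
move=> s1 t1 tM.
have [K [r [K0 r0 r1] hK]] := fallprod_bound s tM.
have [Ks Ks0 hs] := qfac_bounds Hp hq (normr_ge0 s) s1.
have [Kt Kt0 ht] := qfac_bounds Hp hq (normr_ge0 t) t1.
have [Kq Kq0 hKq] := qfac_bounds Hp hq (normr_ge0 q) hq.
have [Ke Ke0 he] := even_rogers_bound (normr_ge0 s) s1.
exists (Ks * (Kq * Kt) * ((2 * Ks) * (Kq * Ks)) * Ke * K), r.
  by split=> //; do ?apply: mulr_ge0.
move=> x l x1.
have sx : `|s * x| <= `|s| by rewrite normrM ler_piMr.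
have tx : `|t * x * q| <= `|t|.
  by rewrite -[q]expr1; apply: le_trans (norm_mulX_le hq _ _) _; rewrite normrM ler_piMr.
have sx2 : `|(s * x) ^+ 2| <= `|s|.
  rewrite expr2 normrM; apply: (le_trans _ sx); rewrite ler_piMr //.
  exact: le_trans sx (ltW s1).
have sx1 : `|(1 - s * x)^-1| <= Ks.
  by have [_] := hs _ 1%N sx; rewrite qfacS qfac0 expr0 mulr1 mul1r.
rewrite /wp_term addn0 subn0 fallprodM.
set e := even_rogers _ _ _ _; set f := fallprod _ _ _ _; set A := (_ / (1 - _) * _).
have hA : `|A| <= (2 * Ks) * (Kq * Ks).
  apply: norm_mul_le; apply: norm_mul_le => //.
  - apply: norm_sub1_le2; apply: le_trans (norm_mulX_le hq _ _) _.
    exact: le_trans sx (ltW s1).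
  - by have [] := hKq q (2 * l)%N (lexx _).
  - by have [] := hs _ (2 * l)%N sx2.
set B := qfac _ (s * x) l; set D := (_ / _).
have -> : D = B * (qfac q q l * qfac q (t * x * q) l)^-1 * (x ^+ l * f).
  by rewrite /D mulrAC.
have hB : `|B * (qfac q q l * qfac q (t * x * q) l)^-1| <= Ks * (Kq * Kt).
  apply: norm_mul_le; first by have [] := hs _ l sx.
  rewrite invfM; apply: norm_mul_le; first by have [] := hKq q l (lexx _).
  by have [] := ht _ l tx.
have hef : `|x ^+ l * f * e| <= Ke * K * (`|x| ^+ l * r ^+ l).
  rewrite -mulrA normrM normrX [leRHS]mulrCA ler_wpM2l ?exprn_ge0 //.
  rewrite normrM; apply: (@le_trans _ _ (`|f| * (Ke * ((2 * l + 1)%:R * M ^+ l)))).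
    by rewrite ler_wpM2l // he.
  by rewrite [leLHS]mulrCA -[leRHS]mulrA; apply: ler_wpM2l (hK l).
rewrite (_ : _ * A * e = B / (qfac q q l * qfac q (t * x * q) l) * A
  * (x ^+ l * f * e)); last by ring.
apply: le_trans (norm_mul_le (norm_mul_le hB hA) hef) _.
by rewrite !mulrA.
Qed.

End WPBase.

(** * The sum at n = 0 *)

Section WPBase2.
Variables (C : numFieldType) (q : C).
Hypotheses (Hp : geo_prod_bounded C) (Hc : geo_complete C) (hq : `|q| < 1).
Variables (z M : C).
Hypotheses (z0 : z != 0) (M1 : 1 <= M) (zM : `|z| <= M) (zVM : `|z^-1| <= M).
Implicit Types (a b s t x : C).

Let M0 : 0 <= M. Proof. exact: le_trans M1. Qed.

(** All factors are bounded except [fallprod] and the polynomials, whose product decays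
    geometrically. *)
Lemma wp_rest_cvg0 s t : `|s| < 1 -> `|t| < 1 -> `|t| * M < 1 ->
  wp_rest q z s t N @[N --> \oo] --> 0.
Proof.
move=> s1 t1 tM.
have [K [r [K0 r0 r1] hK]] := fallprod_bound Hp hq M1 s tM.
have [Ks Ks0 hs] := qfac_bounds Hp hq (normr_ge0 s) s1.
have [Kt Kt0 ht] := qfac_bounds Hp hq (normr_ge0 t) t1.
have [Kq Kq0 hKq] := qfac_bounds Hp hq (normr_ge0 q) hq.
have [Ke Ke0 he] := even_rogers_bound Hp hq z0 M1 zM zVM (normr_ge0 s) s1.
pose Y := (1 - t * z) * (1 - t * z^-1).
pose W := Ks * (Kq * Kt) * (Kq * Ks).
pose L := 2 * Ks * (2 * 2 + 2 * 2) + `|s * Y|.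
have reassoc (a f U V X : C) : a * f * U * V * X = (a * U * V) * (X * f) by ring.
(* The bound starts at l + 1, where [even_rogers_pred] is [even_rogers] at l. *)
have bound l : `|wp_rest q z s t l.+1| <= W * L * Ke * K * r ^+ l.+1.
  set B := Ke * ((2 * l.+1 + 1)%:R * M ^+ l.+1).
  have sq1 : `|s * q| <= `|s| by rewrite -[q]expr1 norm_mulX_le.
  have pB : `|even_rogers_pred q (s * q) z l.+1| <= B.
    rewrite even_rogers_predS //; apply: le_trans (he _ l sq1) _.
    apply: ler_wpM2l => //; apply: ler_pM => //; first exact: exprn_ge0.
      by rewrite ler_nat leq_add2r leq_mul2l leqnSn.
    by rewrite ler_weXn2l.
  have eB : `|even_rogers q (s * q) z l.+1| <= B by exact: he.
  have n1 a : `|a| < 1 -> `|1 - a * q ^+ l.+1| <= 2.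
    move=> a1; apply: norm_sub1_le2; apply: le_trans (norm_mulX_le hq _ _) (ltW a1).
  rewrite /wp_rest -/Y /wp_weight.
  set f := fallprod _ _ _ _; set p := even_rogers_pred _ _ _ _.
  set e := even_rogers _ _ _ _.
  have hX : `|(1 - t * s) / (1 - s * q ^+ (2 * l.+1)) *
     ((t - s * q ^+ l.+1) * (1 - s * q ^+ l.+1) * p
      - (1 - q ^+ l.+1) * (1 - t * q ^+ l.+1) * e) + s * Y * p| <= L * B.
    rewrite /L [leRHS]mulrDl; apply: norm_add_le; last exact: norm_mul_le.
    rewrite -[leRHS]mulrA; apply: norm_mul_le.
      apply: norm_mul_le.
        by apply: norm_sub1_le2; rewrite normrM mulr_ile1 // ltW.
      have [_] := hs (s * q ^+ (2 * l.+1)) 1%N (norm_mulX_le hq _ _).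
      by rewrite qfacS qfac0 expr0 mulr1 mul1r.
    rewrite [leRHS]mulrDl; apply: norm_sub_le; apply: norm_mul_le => //.
      apply: norm_mul_le; last exact: n1.
      apply: (@norm_sub_le _ _ _ 1 1); first exact: ltW.
      exact: le_trans (norm_mulX_le hq _ _) (ltW s1).
    apply: norm_mul_le; last exact: n1.
    by apply: norm_sub1_le2; rewrite normrX exprn_ile1 // ltW.
  set X := (X in `|_ * X|).
  have -> : qfac q s l.+1 * f / (qfac q q l.+1 * qfac q (t * q) l.+1) *
     (qfac q q (2 * l.+1) / qfac q (s ^+ 2) (2 * l.+1)) * X =
     (qfac q s l.+1 * (qfac q q l.+1 * qfac q (t * q) l.+1)^-1 *
     (qfac q q (2 * l.+1) / qfac q (s ^+ 2) (2 * l.+1))) * (X * f).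
    exact: reassoc.
  rewrite -[leRHS]mulrA -[leRHS]mulrA -[leRHS]mulrA; apply: norm_mul_le.
    apply: norm_mul_le; apply: norm_mul_le.
    - by have [] := hs s l.+1 (lexx _).
    - rewrite invfM; apply: norm_mul_le; first by have [] := hKq q l.+1 (lexx _).
      have [|//] := ht (t * q) l.+1.
      by rewrite -[q in X in X <= _]expr1 norm_mulX_le.
    - by have [] := hKq q (2 * l.+1)%N (lexx _).
    - have [|//] := hs (s ^+ 2) (2 * l.+1)%N.
      by rewrite expr2 normrM ler_piMr // ltW.
  rewrite normrM; apply: (@le_trans _ _ (L * B * `|f|)).
    by rewrite ler_wpM2r.
  rewrite /B -!mulrA ler_wpM2l ?addr_ge0 ?mulr_ge0 // ler_wpM2l //.
  by rewrite mulrA [leLHS]mulrC hK.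
rewrite -cvg_shiftS; apply: (norm_le_cvg0 bound).
rewrite -[X in _ --> X](mulr0 (W * L * Ke * K)); apply: cvgM; first exact: cvg_cst.
by rewrite (cvg_shiftS (fun n => r ^+ n)); apply: (expr_cvg0 Hc); rewrite ger0_norm.
Qed.

Lemma wp_sum0_cvg s t : `|s| < 1 -> `|t| < 1 -> `|t| * M < 1 ->
  cvgn (wp_sum q z 0 s t).
Proof.
move=> s1 t1 tM.
have [K [r [K0 r0 r1] hK]] := wp_term_bound Hp hq z0 M1 zM zVM s1 t1 tM.
apply: (@Hc (wp_term q z 0 s t) K r r0 r1) => n.
by have := hK 1 n; rewrite !mulr1 normr1 expr1n mul1r; apply.
Qed.

(** The term l = 0 equals 1, and the others share a factor |x|. *)
Lemma wp_sum0_near1 s t : `|s| < 1 -> `|t| < 1 -> `|t| * M < 1 ->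
  exists K : C, forall x, `|x| <= 1 ->
    `|limn (wp_sum q z 0 (s * x) (t * x)) - 1| <= K * `|x|.
Proof.
move=> s1 t1 tM.
have [K [r [K0 r0 r1] hK]] := wp_term_bound Hp hq z0 M1 zM zVM s1 t1 tM.
exists (K * (1 - r)^-1) => x x1.
have sx : `|s * x| < 1 by rewrite normrM (le_lt_trans _ s1) // ler_piMr.
have tx : `|t * x| < 1 by rewrite normrM (le_lt_trans _ t1) // ler_piMr.
have txM : `|t * x| * M < 1.
  by rewrite (le_lt_trans _ tM) // ler_wpM2r // normrM ler_piMr.
have := wp_sum0_cvg sx tx txM; rewrite -cvg_shiftS => /cvg_norm_le.
apply=> n /=; rewrite /wp_sum big_nat_recl // {1}/wp_term /even_rogers rogers0.
rewrite !muln0 !addn0 !subn0 !qfac0 fallprod0 !expr0 !mulr1 !divr1 divff; last first.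
  by have := sub1_mulX_neq0 hq 0 sx; rewrite expr0 mulr1.
rewrite !mulr1 addrAC subrr add0r.
apply: le_trans (ler_norm_sum _ _ _) _.
apply: (@le_trans _ _ (\sum_(0 <= i < n) K * `|x| * r ^+ i)).
  apply: ler_sum => i _; apply: le_trans (hK x i.+1 x1) _.
  rewrite -mulrA ler_wpM2l // !exprS ler_pM ?mulr_ge0 ?exprn_ge0 //.
    by rewrite ler_piMr // exprn_ile1.
  by rewrite ler_piMl ?exprn_ge0 // ltW.
rewrite -mulr_sumr [leRHS]mulrAC ler_wpM2l ?mulr_ge0 // big_mkord.
exact: sum_expr_le.
Qed.

Lemma qfac_cvg_double a : qfac q a (2 * n) @[n --> \oo] --> qpoch_inf a q.
Proof.
apply/cvgrPdist_lt => e e0.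
have /cvgrPdist_lt/(_ _ e0)[N _ hN] := @qfac_cvg _ _ Hp Hc hq a.
exists N => // n /= Nn; apply: hN => /=; apply: leq_trans Nn _.
by rewrite mul2n -addnn leq_addr.
Qed.

Lemma wp_lim_shift s t : `|s| < 1 -> `|t| < 1 -> `|t| * M < 1 ->
  (1 - t) * (1 - t * q) * ((1 - s ^+ 2) * (1 - s ^+ 2 * q))
    * ((1 - t * z) * (1 - t * z^-1) * limn (wp_sum q z 0 s t))
  = (1 - t ^+ 2) * (1 - t ^+ 2 * q) * ((1 - s) * (1 - s * q))
    * ((1 - s * z) * (1 - s * z^-1) * limn (wp_sum q z 0 (s * q) (t * q))).
Proof.
move=> s1 t1 tM.
have qle a : `|a * q| <= `|a| by rewrite -[q in X in X <= _]expr1 norm_mulX_le.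
have c1 := wp_sum0_cvg s1 t1 tM.
have c2 : cvgn (wp_sum q z 0 (s * q) (t * q)).
  apply: wp_sum0_cvg; [exact: le_lt_trans s1|exact: le_lt_trans t1|].
  by apply: le_lt_trans tM; rewrite ler_wpM2r.
have ss1 : `|s ^+ 2| < 1 by rewrite normrX exprn_ilt1.
set e := (1 - t) * (1 - t * q) * _; set e' := (1 - t ^+ 2) * _ * _.
have E := wp_partial_shift (sub1_X_neq0 hq) z0 (fun i => sub1_mulX_neq0 hq i s1)
  (fun i => sub1_mulX_neq0 hq i ss1) (fun i => sub1_mulX_neq0 hq i t1).
apply: (@cvgn_unique _ (fun N => e * ((1 - t * z) * (1 - t * z^-1) * wp_sum q z 0 s t N))).
  by apply: cvgM; [exact: cvg_cst | apply: cvgM; [exact: cvg_cst | exact: c1]].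
have -> : (fun N => e * ((1 - t * z) * (1 - t * z^-1) * wp_sum q z 0 s t N)) =
  (fun N => e' * ((1 - s * z) * (1 - s * z^-1) * wp_sum q z 0 (s * q) (t * q) N)
     + e * wp_rest q z s t N).
  by apply/funext => N; exact: E.
rewrite -[X in _ --> X]addr0 -[X in _ --> _ + X](mulr0 e).
apply: cvgD; apply: cvgM; try exact: cvg_cst.
  by apply: cvgM; [exact: cvg_cst | exact: c2].
exact: wp_rest_cvg0.
Qed.

(** [wp_lim_shift] at (s q^i, t q^i) for i < k, with denominators cleared. Each step contributes two
    consecutive factors in s^2 and in t^2, hence the length 2k. *)
Lemma wp_lim_iter s t k : `|s| < 1 -> `|t| < 1 -> `|t| * M < 1 ->
  limn (wp_sum q z 0 s t) * (qfac q t k * qfac q (t * q) k * qfac q (s ^+ 2) (2 * k)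
    * (qfac q (t * z) k * qfac q (t * z^-1) k))
  = qfac q (t ^+ 2) (2 * k) * (qfac q s k * qfac q (s * q) k)
    * (qfac q (s * z) k * qfac q (s * z^-1) k)
    * limn (wp_sum q z 0 (s * q ^+ k) (t * q ^+ k)).
Proof.
move=> s1 t1 tM; elim: k => [|k IH].
  by rewrite muln0 !qfac0 expr0 !mulr1 !mul1r.
have E : (1 - t * q ^+ k) * (1 - t * q ^+ k * q) * ((1 - (s * q ^+ k) ^+ 2) *
    (1 - (s * q ^+ k) ^+ 2 * q)) * ((1 - t * q ^+ k * z) * (1 - t * q ^+ k * z^-1)
    * limn (wp_sum q z 0 (s * q ^+ k) (t * q ^+ k)))
  = (1 - (t * q ^+ k) ^+ 2) * (1 - (t * q ^+ k) ^+ 2 * q) *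
    ((1 - s * q ^+ k) * (1 - s * q ^+ k * q)) *
    ((1 - s * q ^+ k * z) * (1 - s * q ^+ k * z^-1)
    * limn (wp_sum q z 0 (s * q ^+ k * q) (t * q ^+ k * q))).
  apply: wp_lim_shift; rewrite ?(le_lt_trans (norm_mulX_le hq _ _)) //.
  by apply: le_lt_trans tM; rewrite ler_wpM2r // norm_mulX_le.
have k2 : q ^+ (2 * k) = (q ^+ k) ^+ 2 by rewrite mulnC exprM.
rewrite mulnS !addSn add0n !qfacS !(exprSr q) !mulrA in E IH *.
rewrite k2; move: E IH.
move: (limn (wp_sum q z 0 (s * q ^+ k * q) _)) (limn (wp_sum q z 0 (s * q ^+ k) _)).
move: (limn (wp_sum q z 0 s t)) => F F2 F1 E IH.
move: (qfac q t k) (qfac q (t * q) k) (qfac q (s ^+ 2) _) (qfac q (t * z) k)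
  (qfac q (t / z) k) (qfac q (t ^+ 2) _) (qfac q s k) (qfac q (s * q) k)
  (qfac q (s * z) k) (qfac q (s / z) k) (q ^+ k) E IH.
move=> A1 A2 A3 A4 A5 B1 B2 B3 B4 B5 x E IH.
(* [G] holds the factors that carry the left side from k to k + 1. *)
pose G := (1 - t * x) * (1 - t * x * q) * (1 - (s * x) ^+ 2)
  * (1 - (s * x) ^+ 2 * q) * (1 - t * x * z) * (1 - t * x / z).
apply: (eq_of_subr (congr2 +%R (congr1 ( *%R G) IH)
  (congr1 ( *%R (B1 * B2 * B3 * B4 * B5)) E))).
by rewrite /G; ring.
Qed.

Lemma wp_sum0_limit s t : `|s| < 1 -> `|t| < 1 -> `|t| * M < 1 ->
  wp_sum q z 0 s t N @[N --> \oo] -->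
  qpochs_inf [:: t ^+ 2; s; s * q; s * z; s * z^-1] q
  / qpochs_inf [:: s ^+ 2; t; t * q; t * z; t * z^-1] q.
Proof.
move=> s1 t1 tM.
suff <- : limn (wp_sum q z 0 s t) = qpochs_inf [:: t ^+ 2; s; s * q; s * z; s * z^-1] q
  / qpochs_inf [:: s ^+ 2; t; t * q; t * z; t * z^-1] q by exact: wp_sum0_cvg.
have qle a : `|a * q| <= `|a| by rewrite -[q in X in X <= _]expr1 norm_mulX_le.
have tz1 : `|t * z| < 1 by apply: le_lt_trans tM; rewrite normrM ler_wpM2l.
have tzV1 : `|t * z^-1| < 1 by apply: le_lt_trans tM; rewrite normrM ler_wpM2l.
have ss1 : `|s ^+ 2| < 1 by rewrite normrX exprn_ilt1.
rewrite /qpochs_inf !big_cons !big_nil !mulr1.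
have neq0 : qpoch_inf (s ^+ 2) q * (qpoch_inf t q * (qpoch_inf (t * q) q *
  (qpoch_inf (t * z) q * qpoch_inf (t / z) q))) != 0.
  by rewrite !mulf_neq0 // (qpoch_inf_neq0 Hp Hc hq) // (le_lt_trans (qle _)).
apply/eqP; rewrite -(can2_eq (mulfK neq0) (mulfVK neq0)); apply/eqP.
have [K hK] := wp_sum0_near1 s1 t1 tM.
have F1 : limn (wp_sum q z 0 (s * q ^+ k) (t * q ^+ k)) @[k --> \oo] --> (1 : C).
  have : limn (wp_sum q z 0 (s * q ^+ k) (t * q ^+ k)) - 1 @[k --> \oo] --> (0 : C).
    apply: (@norm_le_cvg0 _ _ (fun k => K * `|q| ^+ k)) => [k|].
      by rewrite -normrX hK // normrX exprn_ile1 // ltW.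
    rewrite -[X in _ --> X](mulr0 K); apply: cvgM; first exact: cvg_cst.
    by apply: (expr_cvg0 Hc); rewrite normr_id.
  move=> /(cvgD (cvg_cst (1 : C))); rewrite addr0; apply: cvg_trans.
  by apply: near_eq_cvg; near=> k; rewrite /= addrC subrK.
have L := fun a => @qfac_cvg _ _ Hp Hc hq a.
have L2 := qfac_cvg_double.
(* The two sides of [wp_lim_iter] are one sequence in k, whose limit is computed in two ways. *)
apply: (@cvgn_unique _ (fun k => limn (wp_sum q z 0 s t) *
    (qfac q t k * qfac q (t * q) k * qfac q (s ^+ 2) (2 * k)
    * (qfac q (t * z) k * qfac q (t * z^-1) k)))).
  have -> : qpoch_inf (s ^+ 2) q * (qpoch_inf t q * (qpoch_inf (t * q) q *
      (qpoch_inf (t * z) q * qpoch_inf (t / z) q))) = qpoch_inf t q * qpoch_inf (t * q) q *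
    qpoch_inf (s ^+ 2) q * (qpoch_inf (t * z) q * qpoch_inf (t / z) q) by ring.
  apply: cvgM; first exact: cvg_cst.
  by do ?[apply: cvgM]; do ?[exact: L|exact: L2].
set g := (fun k : nat => _).
have -> : g = (fun k => qfac q (t ^+ 2) (2 * k) * (qfac q s k * qfac q (s * q) k)
    * (qfac q (s * z) k * qfac q (s * z^-1) k)
    * limn (wp_sum q z 0 (s * q ^+ k) (t * q ^+ k))).
  by apply/funext => k; rewrite /g wp_lim_iter.
have -> : qpoch_inf (t ^+ 2) q * (qpoch_inf s q * (qpoch_inf (s * q) q
    * (qpoch_inf (s * z) q * qpoch_inf (s / z) q)))
  = qpoch_inf (t ^+ 2) q * (qpoch_inf s q * qpoch_inf (s * q) q)
    * (qpoch_inf (s * z) q * qpoch_inf (s / z) q) * 1 by ring.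
apply: cvgM => //; by do ?[apply: cvgM]; do ?[exact: L|exact: L2].
Unshelve. all: by end_near.
Qed.

End WPBase2.

(** * The case q = 0 *)

Section QZero.
Variable C : numFieldType.
Implicit Types (a s z : C).

Lemma qfac_q0 a n : (0 < n)%N -> qfac 0 a n = 1 - a.
Proof.
case: n => // n _; rewrite qfac_recl mulr0 /qfac big1 ?mulr1 // => i _.
by rewrite mul0r subr0.
Qed.

(** At q = t = 0 a [fallprod] of length at least two contains the factor 0 - s 0^1, so only l = n
    and l = n + 1 contribute; [rogers_raise] adds the two. *)
Lemma wp_sum_q0 s z n N : z != 0 -> 1 - s != 0 -> 1 - s ^+ 2 != 0 ->
  (0 < n)%N -> (n.+2 <= N)%N ->
  wp_sum 0 z n s 0 N = (1 - s) * ((1 - s * z) * (1 - s * z^-1)) / (1 - s ^+ 2)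
    * wp_value 0 z 0 n.
Proof.
move=> z0 s1 ss1 n0 nN.
have q1 i : 1 - (0 : C) ^+ i.+1 != 0 by rewrite expr0n subr0 oner_neq0.
(* Since 0^0 = 1, it is 0 < n that makes q^(2n) vanish. *)
have X0 k : (0 < k)%N -> (0 : C) ^+ k = 0 by rewrite expr0n; case: k.
have qq k : qfac (0 : C) 0 k = 1 by rewrite /qfac big1 // => i _; rewrite mul0r subr0.
have n2 : (0 < 2 * n)%N by rewrite muln_gt0.
have E := rogers_raise q1 s (2 * n) z0.
rewrite !X0 // !mulr0 !subr0 !mulr1 !mul1r in E.
have T l : (n <= l)%N -> wp_term 0 z n s 0 l
    = fallprod 0 s 0 (l - n) / (1 - s ^+ 2) * even_rogers 0 s z l.
  move=> nl; have l0 := leq_trans n0 nl.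
  rewrite /wp_term !mulr0 !qq !qfac_q0 ?muln_gt0 ?addn_gt0 ?l0 //.
  rewrite X0 ?muln_gt0 ?l0 // mulr0 subr0.
  by field; rewrite s1 ss1.
rewrite /wp_sum big_ltn ?(leq_trans _ nN) // big_ltn // big_nat_cond big1 ?addr0.
  rewrite !T // subnn subSnn fallprodS !fallprod0 expr0 mulr1.
  rewrite /wp_value X0 // !qq /even_rogers mulnS !addSn add0n (exprS z^-1 n).
  transitivity (z^-1 ^+ n / (1 - s ^+ 2) *
     (rogers 0 s z (2 * n) - s * (z^-1 * rogers 0 s z (2 * n).+2))).
    by field; rewrite ss1 z0.
  by rewrite E; field; rewrite ss1 z0.
move=> l /andP[/andP[nl _] _].
rewrite T; last by rewrite ltnW // ltnW.
have -> : fallprod 0 s 0 (l - n) = 0.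
  have -> : (l - n)%N = (l - n.+2).+2 by lia.
  apply/eqP/prodf_eq0; exists (Ordinal (isT : (1 < (l - n.+2).+2)%N)) => //.
  by rewrite /= expr1 mulr0 subr0.
by rewrite !mul0r.
Qed.

End QZero.

(** * The limit for every n *)

Section WPAll.
Variables (C : numFieldType) (q : C).
Hypotheses (Hp : geo_prod_bounded C) (Hc : geo_complete C) (hq : `|q| < 1).
Variables (z M s : C).
Hypotheses (z0 : z != 0) (M1 : 1 <= M) (zM : `|z| <= M) (zVM : `|z^-1| <= M).
Hypothesis s1 : `|s| < 1.
Implicit Types t : C.

(** Value of the series at n = 0, by [wp_sum0_limit]. *)
Let V t := qpochs_inf [:: t ^+ 2; s; s * q; s * z; s * z^-1] q
  / qpochs_inf [:: s ^+ 2; t; t * q; t * z; t * z^-1] q.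

Let qle a : `|a * q| <= `|a|.
Proof. by rewrite -[q in X in X <= _]expr1 norm_mulX_le. Qed.

Let V_shift t : `|t| < 1 -> `|t| * M < 1 ->
  V (t * q) = V t * ((1 - t) * (1 - t * q) * ((1 - t * z) * (1 - t * z^-1))
    / ((1 - t ^+ 2) * (1 - t ^+ 2 * q))).
Proof.
move=> t1 tM.
have tz1 : `|t * z| < 1 by apply: le_lt_trans tM; rewrite normrM ler_wpM2l.
have tzV1 : `|t * z^-1| < 1 by apply: le_lt_trans tM; rewrite normrM ler_wpM2l.
have ss1 : `|s ^+ 2| < 1 by rewrite normrX exprn_ilt1.
have tt1 : `|t ^+ 2| < 1 by rewrite normrX exprn_ilt1.
have step a : qpoch_inf a q = (1 - a) * qpoch_inf (a * q) q.
  by have := qpoch_inf_qfac Hp Hc hq a 1; rewrite qfacS qfac0 expr0 expr1 mulr1 mul1r.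
have n0 (a : C) : `|a| < 1 -> 1 - a != 0.
  by move=> a1; have := sub1_mulX_neq0 hq 0 a1; rewrite expr0 mulr1.
have u0 (a : C) : `|a| < 1 -> qpoch_inf a q != 0 by exact: (qpoch_inf_neq0 Hp Hc hq).
have lt1 (a : C) : `|a| < 1 -> `|a * q| < 1 by apply: le_lt_trans (qle a).
rewrite /V /qpochs_inf !big_cons !big_nil !mulr1.
have -> : (t * q) ^+ 2 = t ^+ 2 * q * q by ring.
have -> : t * q * z = t * z * q by ring.
have -> : t * q / z = t / z * q by ring.
have -> : qpoch_inf (t ^+ 2) q
    = (1 - t ^+ 2) * ((1 - t ^+ 2 * q) * qpoch_inf (t ^+ 2 * q * q) q).
  by rewrite -!step.
have -> : qpoch_inf t q = (1 - t) * ((1 - t * q) * qpoch_inf (t * q * q) q).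
  by rewrite -!step.
have -> : qpoch_inf (t * q) q = (1 - t * q) * qpoch_inf (t * q * q) q by rewrite -step.
rewrite [qpoch_inf (t * z) q]step [qpoch_inf (t / z) q]step.
have g1 := n0 _ t1; have g2 := n0 _ (lt1 _ t1); have g3 := n0 _ tz1; have g4 := n0 _ tzV1.
have g5 := n0 _ tt1; have g6 := n0 _ (lt1 _ tt1).
have h1 := u0 _ ss1; have h2 := u0 _ (lt1 _ (lt1 _ t1)).
have h3 := u0 _ (lt1 _ tz1); have h4 := u0 _ (lt1 _ tzV1).
move: (qpoch_inf (s ^+ 2) q) (qpoch_inf (t * q * q) q) (qpoch_inf (t * z * q) q)
  (qpoch_inf (t / z * q) q) h1 h2 h3 h4.
move: (1 - t) (1 - t * q) (1 - t * z) (1 - t / z) (1 - t ^+ 2) (1 - t ^+ 2 * q) g1 g2 g3 g4 g5 g6.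
move=> a1 a2 a3 a4 a5 a6 g1 g2 g3 g4 g5 g6 b1 b2 b3 b4 h1 h2 h3 h4.
by field; rewrite g1 g2 g3 g4 g5 g6 h1 h2 h3 h4.
Qed.

(** Induction on n for all t at once, as the step uses the case n at tq as well as at t. The
    condition [t = 0 -> q = 0] passes from a nonzero t to tq, which can vanish only for q = 0. *)
Lemma wp_sum_limit n t : `|t| < 1 -> `|t| * M < 1 -> (t = 0 -> q = 0) ->
  wp_sum q z n s t N @[N --> \oo] -->
  qpochs_inf [:: t ^+ 2; s; s * q; s * z; s * z^-1] q
  / qpochs_inf [:: s ^+ 2; t; t * q; t * z; t * z^-1] q * wp_value q z t n.
Proof.
rewrite -/(V t); elim: n t => [|n IH] t t1 tM tq.
  rewrite /wp_value /even_rogers muln0 !qfac0 rogers0 expr0 divr1 !mulr1.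
  exact: (wp_sum0_limit Hp Hc hq z0 M1 zM zVM).
have tt1 : `|t ^+ 2| < 1 by rewrite normrX exprn_ilt1.
have ss1 : `|s ^+ 2| < 1 by rewrite normrX exprn_ilt1.
have n0 (a : C) : `|a| < 1 -> 1 - a != 0.
  by move=> a1; have := sub1_mulX_neq0 hq 0 a1; rewrite expr0 mulr1.
(* At t = 0 the relation cannot be solved for the sum at n + 1; the explicit sum at q = 0 takes
   over. *)
have [t0|t0] := eqVneq t 0.
  have q0 := tq t0.
  have Vq : V t = (1 - s) * ((1 - s * z) * (1 - s * z^-1)) / (1 - s ^+ 2).
    (* At q = 0 the infinite product reduces to its first factor. *)
    have q0E a : qpoch_inf a q = 1 - a.
      have := qpoch_inf_qfac Hp Hc hq a 1; rewrite qfacS qfac0 expr0 expr1 mulr1 mul1r.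
      rewrite q0 mulr0 => ->; rewrite -[RHS]mulr1; congr (_ * _).
      apply: (@cvgn_unique _ (fun=> 1)); last exact: cvg_cst.
      have := @qfac_cvg _ q Hp Hc hq 0; rewrite q0.
      rewrite (_ : qfac 0 0 = fun=> 1) //; apply/funext => k.
      by rewrite /qfac big1 // => i _; rewrite mul0r subr0.
    rewrite /V /qpochs_inf !big_cons !big_nil !q0E t0 q0 !(mulr0, mul0r, expr0n) /=.
    by rewrite !(subr0, mulr1, mul1r).
  apply: (@cvg_near_cst _ _ _ _ \oo); near=> N.
  rewrite Vq t0 q0; apply: wp_sum_q0 => //; [exact: n0|exact: n0|].
  by near: N; exists n.+3.
have tE N : wp_sum q z n.+1 s t N = t^-1 * (wp_sum q z n s t N
    - (1 - t * q ^+ (2 * n).+1) / (1 - t * q) * wp_sum q z n s (t * q) N).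
  rewrite -(wp_sum_nshift (sub1_X_neq0 hq) z s (fun i => sub1_mulX_neq0 hq i t1)).
  by rewrite opprB addrC subrK mulKf.
rewrite (funext tE).
have tqM : `|t * q| * M < 1.
  by apply: le_lt_trans tM; rewrite ler_wpM2r // (le_trans _ M1).
have tq1 : `|t * q| < 1 by apply: le_lt_trans t1.
have -> : V t * wp_value q z t n.+1 = t^-1 * (V t * wp_value q z t n
    - (1 - t * q ^+ (2 * n).+1) / (1 - t * q) * (V (t * q) * wp_value q z (t * q) n)).
  rewrite V_shift //.
  have := wp_value_nshift (sub1_X_neq0 hq) z0 (fun i => sub1_mulX_neq0 hq i tt1) n.
  have g1 := n0 _ tt1; have g2 := n0 _ tq1.
  have g3 : 1 - t ^+ 2 * q != 0 by apply: n0; apply: le_lt_trans tt1.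
  move: (wp_value q z t n) (wp_value q z t n.+1) (wp_value q z (t * q) n) (V t).
  move=> v0 v1 v2 v E.
  rewrite (_ : v0 = (v0 - t * v1) + t * v1); last by rewrite subrK.
  rewrite E; move: g1 g2 g3 => g1 g2 g3.
  move: (1 - t * q ^+ _) ((1 - t * z) * _) => X Y.
  by field; rewrite g1 g2 g3 t0.
apply: cvgM; first exact: cvg_cst.
apply: cvgB; first exact: IH.
apply: cvgM; first exact: cvg_cst.
by apply: IH => // /eqP; rewrite mulf_eq0 (negPf t0) /= => /eqP.
Unshelve. all: by end_near.
Qed.

End WPAll.

(** * Convergence of the series forces |tz| < 1 *)

Section Divergence.
Variables (C : numFieldType) (q : C).
Hypotheses (Hp : geo_prod_bounded C) (Hc : geo_complete C) (hq : `|q| < 1).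
Implicit Types (a b w : C) (u v : nat -> C).

Let qX_cvg0 c m : c * q ^+ (2 * l + m) @[l --> \oo] --> 0.
Proof.
apply: (@norm_le_cvg0 _ _ (fun l => `|c| * `|q| ^+ l)) => [l|].
  rewrite normrM normrX ler_wpM2l //.
  by apply: ler_wiXn2l => //; [exact: ltW | rewrite mul2n -addnn -addnA leq_addr].
rewrite -[X in _ --> X](mulr0 `|c|); apply: cvgM; first exact: cvg_cst.
by apply: (expr_cvg0 Hc); rewrite normr_id.
Qed.

Let sub_qX_cvg a c m : a - c * q ^+ (2 * l + m) @[l --> \oo] --> a.
Proof.
by rewrite -[X in _ --> X]subr0; apply: cvgB; [exact: cvg_cst | exact: qX_cvg0].
Qed.

Let one_add_neq0 w : `|w| < 1 -> 1 + w != 0.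
Proof.
move=> w1; have := @sub1_mulX_neq0 _ _ hq (- w) 0.
by rewrite expr0 mulr1 opprK; apply; rewrite normrN.
Qed.

(** The three-term recurrence carries the limit 0 over to odd indices, and [rogers_qshift] then
    expresses the polynomial at qw through both parities at w. *)
Lemma rogers_even_cvg0_shift b w : `|b| < 1 -> `|w| < 1 ->
  rogers q b w (2 * l) @[l --> \oo] --> 0 ->
  rogers q b (q * w) (2 * l) @[l --> \oo] --> 0.
Proof.
move=> b1 w1 h.
have hS : rogers q b w (2 * l).+2 @[l --> \oo] --> 0.
  move: h; rewrite -(cvg_shiftS (fun l => rogers q b w (2 * l))) /=.
  by under eq_fun do rewrite mulnS.
have odd : rogers q b w (2 * l).+1 @[l --> \oo] --> 0.
  have e l : rogers q b w (2 * l).+1 = ((1 + w) * (1 - b * q ^+ (2 * l + 1)))^-1 *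
    ((1 - 1 * q ^+ (2 * l + 2)) * rogers q b w (2 * l).+2
     + w * (1 - b ^+ 2 * q ^+ (2 * l + 0)) * rogers q b w (2 * l)).
    have E := rogers_rec (sub1_X_neq0 hq) b w (2 * l).
    have d0 : (1 + w) * (1 - b * q ^+ (2 * l).+1) != 0.
      by apply: mulf_neq0; [exact: one_add_neq0 | exact: sub1_mulX_neq0].
    by rewrite addn0 addn1 addn2 mul1r E subrK mulKf.
  rewrite (funext e) -[X in _ --> X](mulr0 ((1 + w) * 1)^-1); apply: cvgM.
    apply: cvgV; first by rewrite mulr1 one_add_neq0.
    by apply: cvgM; [exact: cvg_cst | exact: sub_qX_cvg].
  rewrite [X in _ --> X](_ : _ = 1 * 0 + w * 1 * 0); last by rewrite !mulr0 addr0.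
  apply: cvgD; apply: cvgM => //.
  by apply: cvgM; [exact: cvg_cst | exact: sub_qX_cvg].
have bw : 1 - b * w != 0.
  have := @sub1_mulX_neq0 _ _ hq (b * w) 0; rewrite expr0 mulr1; apply.
  by rewrite normrM mulr_ilt1.
have e l : rogers q b (q * w) (2 * l) = (1 - b * w)^-1 *
  ((1 - 1 * q ^+ (2 * l + 1)) * rogers q b w (2 * l).+1
   - (w - b * q ^+ (2 * l + 0)) * rogers q b w (2 * l)).
  have E := rogers_qshift (sub1_X_neq0 hq) b w (2 * l).
  by rewrite addn0 addn1 mul1r E addrAC subrr add0r mulKf.
rewrite (funext e) -[X in _ --> X](mulr0 (1 - b * w)^-1); apply: cvgM; first exact: cvg_cst.
rewrite [X in _ --> X](_ : _ = 1 * 0 - w * 0); last by rewrite !mulr0 subr0.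
by apply: cvgB; apply: cvgM => //; exact: sub_qX_cvg.
Qed.

Lemma rogers_even_not_cvg0 b w : `|b| < 1 -> `|w| < 1 ->
  ~ (rogers q b w (2 * l) @[l --> \oo] --> 0).
Proof.
move=> b1 w1 h.
have hk k : rogers q b (q ^+ k * w) (2 * l) @[l --> \oo] --> 0.
  elim: k => [|k IH]; first by rewrite expr0 mul1r.
  rewrite exprS -mulrA; apply: rogers_even_cvg0_shift => //.
  by rewrite mulrC (le_lt_trans (norm_mulX_le hq _ _)).
have [K K0 hK] := qratio_bound Hp hq (normr_ge0 b) b1.
pose A := qpoch_inf b q / qpoch_inf q q.
have q0 : qpoch_inf q q != 0 by exact: (qpoch_inf_neq0 Hp Hc hq).
have A0 : A != 0 by rewrite mulf_neq0 ?invr_eq0 // (qpoch_inf_neq0 Hp Hc hq).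
have Acvg : qratio q b (2 * l) @[l --> \oo] --> A.
  apply: cvgM; first exact: (qfac_cvg_double Hp Hc hq).
  by apply: cvgV => //; exact: (qfac_cvg_double Hp Hc hq).
(* The constant term of the polynomial in x is [qratio q b (2 * l)], which tends to [A]; its other
   powers satisfy |x^(i+1)| <= |q|^k |w|^i. *)
have bd k : `|A| <= K * K * (1 - `|w|)^-1 * `|q| ^+ k.
  set x := q ^+ k * w.
  have xw : `|x| <= `|w| by rewrite /x mulrC norm_mulX_le.
  have : qratio q b (2 * l) - rogers q b x (2 * l) @[l --> \oo] --> A - 0.
    by apply: cvgB => //; exact: hk.
  move=> /cvg_norm_le => /(_ 0 (K * K * (1 - `|w|)^-1 * `|q| ^+ k)).
  rewrite !subr0; apply=> l; rewrite subr0 distrC.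
  rewrite /rogers big_ord_recl subn0 expr0 {1}/qratio !qfac0 divr1 mul1r mulr1.
  rewrite addrAC subrr add0r; apply: le_trans (ler_norm_sum _ _ _) _.
  apply: (@le_trans _ _ (\sum_(i < 2 * l) K * K * (`|q| ^+ k * `|w| ^+ i))).
    apply: ler_sum => i _; rewrite normrM; apply: ler_pM => //.
      by apply: norm_mul_le; apply: hK.
    rewrite normrX exprS; apply: ler_pM => //; rewrite ?exprn_ge0 //.
      by rewrite /x normrM normrX ler_piMr ?exprn_ge0 // ltW.
    by rewrite lerXn2r.
  rewrite -!mulr_sumr -[leRHS]mulrA ler_wpM2l ?mulr_ge0 // [leRHS]mulrC.
  by rewrite ler_wpM2l ?exprn_ge0 // sum_expr_le.
have : A @[_ --> \oo] --> 0.
  apply: (@norm_le_cvg0 _ (fun=> A) _ bd).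
  rewrite -[X in _ --> X](mulr0 (K * K * (1 - `|w|)^-1)); apply: cvgM; first exact: cvg_cst.
  by apply: (expr_cvg0 Hc); rewrite normr_id.
move=> /(@cvgn_unique _ (fun=> A) _ _ (cvg_cst A)) e.
by rewrite e eqxx in A0.
Qed.

(** The term is (tz)^l C_(2l)(z^-1; s) times a factor with nonzero limit; if |tz| >= 1, the
    polynomials would tend to 0, against [rogers_even_not_cvg0]. *)
Lemma wp_term_cvg0_lt1 s t z : `|s| < 1 -> `|t| < 1 -> t != 0 -> z != 0 ->
  qpoch_inf (s * t^-1) q != 0 -> `|z^-1| < 1 ->
  wp_term q z 0 s t l @[l --> \oo] --> 0 -> `|t * z| < 1.
Proof.
move=> s1 t1 t0 z0 st0 z1 h.
rewrite real_ltNge ?normr_real ?real1 //; apply/negP => tz1.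
apply: (@rogers_even_not_cvg0 s z^-1 s1 z1).
(* The factor with nonzero limit; [2 * l + 0] matches the form of [sub_qX_cvg]. *)
pose co l := qfac q s l * qfac q (s * t^-1) l / (qfac q q l * qfac q (t * q) l)
  * ((1 - s * q ^+ (2 * l + 0)) / (1 - s) * (qfac q q (2 * l) / qfac q (s ^+ 2) (2 * l))).
have tq1 : `|t * q| < 1.
  by apply: le_lt_trans t1; rewrite -[q in X in X <= _]expr1 norm_mulX_le.
have ss1 : `|s ^+ 2| < 1 by rewrite normrX exprn_ilt1.
have u0 (a : C) : `|a| < 1 -> qpoch_inf a q != 0 by exact: (qpoch_inf_neq0 Hp Hc hq).
have s2 : 1 - s != 0 by have := sub1_mulX_neq0 hq 0 s1; rewrite expr0 mulr1.
pose L := qpoch_inf s q * qpoch_inf (s * t^-1) q / (qpoch_inf q q * qpoch_inf (t * q) q)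
  * (1 / (1 - s) * (qpoch_inf q q / qpoch_inf (s ^+ 2) q)).
have L0 : L != 0.
  by do ?[apply: mulf_neq0 | rewrite invr_eq0 | exact: oner_neq0 | exact: u0 | done].
have Lc := fun a => @qfac_cvg _ _ Hp Hc hq a.
have Lc2 := fun a => @qfac_cvg_double _ _ Hp Hc hq a.
have coc : co l @[l --> \oo] --> L.
  apply: cvgM; apply: cvgM.
  - by apply: cvgM; exact: Lc.
  - apply: cvgV; first by rewrite mulf_neq0 ?u0.
    by apply: cvgM; exact: Lc.
  - by apply: cvgM; [exact: sub_qX_cvg | exact: cvg_cst].
  - apply: cvgM; first exact: Lc2.
    by apply: cvgV; [exact: u0 | exact: Lc2].
have := cvg_norm (cvgM h (cvgV L0 coc)); rewrite mul0r normr0 => hh.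
apply: (@norm_le_cvg0 _ _ (fun l => `|wp_term q z 0 s t l * (co l)^-1|)) => [l|]; last exact: hh.
have f0 (a : C) n : `|a| < 1 -> qfac q a n != 0.
  by move=> a1; apply: qfac_unit => i; exact: sub1_mulX_neq0.
have co0 : co l != 0.
  have h1 : qfac q (s * t^-1) l != 0.
    by move: st0; rewrite (qpoch_inf_qfac Hp Hc hq _ l) mulf_eq0 negb_or => /andP[].
  have h2 := sub1_mulX_neq0 hq (2 * l + 0) s1.
  by do ?[apply: mulf_neq0 | rewrite invr_eq0 | exact: f0 | done].
have -> : wp_term q z 0 s t l = (t * z) ^+ l * rogers q s z^-1 (2 * l) * co l.
  rewrite /wp_term addn0 subn0 -(even_rogersV q s l z0) /even_rogers invrK.
  rewrite (fallprod_qfac q s l t0) exprMn /co addn0.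
  move: (_ / (1 - s) * _) (_^-1) => X Y; ring.
rewrite mulfK // normrM -[leLHS]mul1r ler_wpM2r // normrX exprn_ege1 //.
Qed.

End Divergence.

(** * Assembly of the conjugate pair *)

Section Conjugate.
Variables (C : numFieldType) (q s t z : C).
Hypotheses (Hp : geo_prod_bounded C) (Hc : geo_complete C).
Hypotheses (hq : `|q| < 1) (ht : `|t| < 1) (hs : `|s| < 1) (z0 : z != 0) (t0 : t != 0).
Hypothesis hst : forall m, qpoch_inf (s * t^-1 * q ^+ m) q != 0.

Lemma rogers_sumE b n : `|b| < 1 ->
  \sum_(0 <= j < (2 * n).+1) (qpoch b q j * qpoch b q (2 * n - j))
      / (qpoch q q j * qpoch q q (2 * n - j)) * z ^ (j%:Z - n%:Z)
  = even_rogers q b z n.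
Proof.
move=> b1; rewrite big_mkord /even_rogers /rogers mulr_sumr; apply: eq_bigr => j _.
rewrite !(qpochE_lt1 Hp Hc hq) // expfzDr // -exprnN -exprVn /qratio invfM.
by rewrite -!exprnP; ring.
Qed.

Let k0 := qpoch_inf (s ^+ 2) q / (qpoch_inf s q * qpoch_inf (s * q) q).

(** The factor t^l of [delta'] splits as t^n t^(l-n), and t^(l-n) merges with (s/t; q)_(l-n) into
    [fallprod]. *)
Lemma WP_partial_sumE n N :
  WP_partial_sum s t q (delta' q s t z) n N = k0 * t ^+ n * wp_sum q z n s t N.
Proof.
have tq1 : `|t * q| < 1.
  by apply: le_lt_trans ht; rewrite -[q in X in X <= _]expr1 norm_mulX_le.
have ss1 : `|s ^+ 2| < 1 by rewrite normrX exprn_ilt1.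
rewrite /WP_partial_sum /wp_sum mulr_sumr; apply: eq_big_nat => l /andP[nl _].
rewrite /delta' rogers_sumE // qpochE // !(qpochE_lt1 Hp Hc hq) //.
rewrite /qpochs_inf !big_cons big_nil mulr1 /wp_term (fallprod_qfac q s _ t0) /k0.
have -> : t ^+ l = t ^+ n * t ^+ (l - n) by rewrite -exprD subnKC.
by rewrite !invfM; ring.
Qed.

(** M is the larger of |z| and |z^-1|, which is at least 1. *)
Lemma norm_bound_exists : `|t * z| < 1 -> `|t * z^-1| < 1 ->
  exists M : C, [/\ 1 <= M, `|z| <= M, `|z^-1| <= M & `|t| * M < 1].
Proof.
move=> tz tzV; have z0' : 0 < `|z| by rewrite normr_gt0.
have [z1|z1] := real_leP (normr_real z) (real1 C).
  have zV : 1 <= `|z^-1| by rewrite normfV invf_ge1.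
  by exists `|z^-1|; split=> //; [exact: le_trans zV|rewrite -normrM].
exists `|z|; split=> //; [exact: ltW| |by rewrite -normrM].
by rewrite normfV (le_trans _ (ltW z1)) // invf_le1 // ltW.
Qed.

(** One of |z| and |z^-1| is at most 1, and there |t| < 1 suffices; for the other, the terms of the
    convergent series tend to 0 and [wp_term_cvg0_lt1] applies. *)
Lemma norm_mul_lt1 : cvgn (WP_partial_sum s t q (delta' q s t z) 0) ->
  `|t * z| < 1 /\ `|t * z^-1| < 1.
Proof.
move=> cv.
have k00 : k0 != 0.
  have sq1 : `|s * q| < 1.
    by apply: le_lt_trans hs; rewrite -[q in X in X <= _]expr1 norm_mulX_le.
  have ss1 : `|s ^+ 2| < 1 by rewrite normrX exprn_ilt1.
  by rewrite /k0 mulf_neq0 ?invr_eq0 ?mulf_neq0 ?(qpoch_inf_neq0 Hp Hc hq).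
have T0 : wp_term q z 0 s t l @[l --> \oo] --> 0.
  apply: cvg_series_cvg_0.
  have e : series (wp_term q z 0 s t)
    = (fun N => k0^-1 * WP_partial_sum s t q (delta' q s t z) 0 N).
    by apply/funext => N; rewrite WP_partial_sumE expr0 mulr1 mulKf.
  rewrite e; apply: is_cvgM => //; exact: is_cvg_cst.
have st0 : qpoch_inf (s * t^-1) q != 0 by have := hst 0; rewrite expr0 mulr1.
have z0' : 0 < `|z| by rewrite normr_gt0.
have lt y : `|y| <= 1 -> `|t * y| < 1.
  by move=> y1; apply: le_lt_trans ht; rewrite normrM ler_piMr.
have [z1|z1] := real_leP (normr_real z) (real1 C).
  split; first exact: lt.
  have [/lt//|zV] := real_leP (normr_real z^-1) (real1 C).
  have zz : z^-1 != 0 by rewrite invr_eq0.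
  (* Here |z| < 1, so the criterion is used at z^-1; the terms are symmetric in z and z^-1. *)
  apply: (wp_term_cvg0_lt1 Hp Hc hq hs ht t0 zz st0).
    by rewrite invrK; move: zV; rewrite normfV invf_gt1.
  suff -> : wp_term q z^-1 0 s t = wp_term q z 0 s t by [].
  by apply/funext => l; rewrite /wp_term even_rogersV.
have zV1 : `|z^-1| < 1 by rewrite normfV invf_lt1.
by split; [exact: (wp_term_cvg0_lt1 Hp Hc hq hs ht t0 z0 st0) | apply: lt; exact: ltW].
Qed.

Lemma conjugate_pair : WP_series_cvg s t q (delta' q s t z) ->
  conjugate_WP_Bailey_pair s t q (gamma' q s t z) (delta' q s t z).
Proof.
move=> cv n.
have [tz tzV] := norm_mul_lt1 (cv 0%N).
have [M [M1 zM zVM tM]] := norm_bound_exists tz tzV.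
have sq1 : `|s * q| < 1.
  by apply: le_lt_trans hs; rewrite -[q in X in X <= _]expr1 norm_mulX_le.
have ss1 : `|s ^+ 2| < 1 by rewrite normrX exprn_ilt1.
have tt1 : `|t ^+ 2| < 1 by rewrite normrX exprn_ilt1.
have tq1 : `|t * q| < 1.
  by apply: le_lt_trans ht; rewrite -[q in X in X <= _]expr1 norm_mulX_le.
have H := @wp_sum_limit _ _ Hp Hc hq z M s z0 M1 zM zVM hs n t ht tM.
rewrite (funext (WP_partial_sumE n)).
have -> : gamma' q s t z n = k0 * t ^+ n *
  (qpochs_inf [:: t ^+ 2; s; s * q; s * z; s * z^-1] q
  / qpochs_inf [:: s ^+ 2; t; t * q; t * z; t * z^-1] q * wp_value q z t n).
  rewrite /gamma' rogers_sumE // !(qpochE_lt1 Hp Hc hq) // /wp_value /k0.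
  rewrite /qpochs_inf !big_cons !big_nil !mulr1.
  have h1 := qpoch_inf_neq0 Hp Hc hq hs; have h2 := qpoch_inf_neq0 Hp Hc hq sq1.
  have h3 := qpoch_inf_neq0 Hp Hc hq ss1.
  have h4 := qpoch_inf_neq0 Hp Hc hq ht; have h5 := qpoch_inf_neq0 Hp Hc hq tq1.
  have h6 := qpoch_inf_neq0 Hp Hc hq tz; have h7 := qpoch_inf_neq0 Hp Hc hq tzV.
  have h8 := qfac_unit (2 * n) (fun i => sub1_mulX_neq0 hq i tt1).
  by field; rewrite h1 h2 h3 h4 h5 h6 h7 h8.
apply: cvgM; first exact: cvg_cst.
by apply: H => /eqP; rewrite (negPf t0).
Qed.

End Conjugate.


Theorem theorem6p1 (R : realType) (q s t z : R[i])
  (hq : `|q| < 1) (ht : `|t| < 1) (hs : `|s| < 1) (hz : z != 0) (ht0 : t != 0)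
  (* the denominators not already nonzero by the bounds above *)
  (hst : forall m : nat, qpoch_inf (s * t^-1 * q ^+ m) q != 0)
  (htz : qpoch_inf (t * z) q != 0)
  (htzV : qpoch_inf (t * z^-1) q != 0)
  (* convergence of the series *)
  (hcvg : WP_series_cvg s t q (delta' q s t z)) :
  conjugate_WP_Bailey_pair s t q (gamma' q s t z) (delta' q s t z).
Proof.
exact: (conjugate_pair (@complex_geo_prod_bounded R) (@complex_geo_complete R)).
Qed.
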